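(* Let $(\mathfrak{g},[\,,\,],\langle\,,\,\rangle)$ be a finite-dimensional real Lorentzian Lie algebra whose center $Z(\mathfrak{g})$ is degenerate. Then $(\mathfrak{g},\langle\,,\,\rangle)$ is flat if and only if it is a double extension of a Riemannian flat Lie algebra $(B,[\,,\,]_0,\langle\,,\,\rangle_0)$ according to some admissible $(\xi,D,0,b_0)$ (i.e. with $\mu=0$) with $(D,b_0)\neq(0,0)$. Moreover, every Lorentzian flat Lie algebra with degenerate center is unimodular and hence complete.
   Context: All Lie algebras are real and finite-dimensional. A pseudo-Riemannian Lie algebra is a Lie algebra $\mathfrak{g}$ with a nondegenerate symmetric bilinear form $\langle\,,\,\rangle$ (an inner product), which corresponds to a left-invariant pseudo-Riemannian metric on a Lie group with Lie algebra $\mathfrak{g}$; it is Riemannian if the form is positive definite and Lorentzian if it has signature $(-,+,\dots,+)$. A subspace is degenerate if the restriction of $\langle\,,\,\rangle$ to it is degenerate. The Levi-Civita product $(u,v)\mapsto uv$ on $\mathfrak{g}$ is defined by $2\langle uv,w\rangle=\langle[u,v],w\rangle+\langle[w,u],v\rangle+\langle[w,v],u\rangle$; $\mathrm{L}_u v=uv$ and $\mathrm{R}_u v=vu$. The pseudo-Riemannian Lie algebra is flat if $\mathrm{L}_{[u,v]}=[\mathrm{L}_u,\mathrm{L}_v]$ for all $u,v\in\mathfrak{g}$. It is unimodular if $\mathrm{tr}(\mathrm{ad}_u)=0$ for all $u\in\mathfrak g$, and a pseudo-Riemannian flat Lie algebra is complete if the corresponding left-invariant metric on the Lie group is (geodesically)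 complete. Admissibility and double extension. Let $(B,[\,,\,]_0,\langle\,,\,\rangle_0)$ be a pseudo-Riemannian flat Lie algebra with Levi-Civita product $(a,b)\mapsto ab$, let $\xi,D:B\to B$ be linear endomorphisms, $b_0\in B$ and $\mu\in\mathbb{R}$. The tuple $(\xi,D,\mu,b_0)$ is called admissible if: (1) $\xi([a,b]_0)=a\,\xi(b)-b\,\xi(a)$ for all $a,b\in B$; (2) $D$ is a derivation of $(B,[\,,\,]_0)$; (3) $D-\xi$ is skew-symmetric with respect to $\langle\,,\,\rangle_0$, $[D,\xi]=\xi^2-\mu\xi-\mathrm{R}_{b_0}$ (where $\mathrm{R}_{b_0}a=ab_0$), and $a\,\xi(b)-\xi(ab)=D(a)b+aD(b)-D(ab)$ for all $a,b\in B$. Given an admissible $(\xi,D,\mu,b_0)$, the double extension of $B$ according to $(\xi,D,\mu,b_0)$ is the vector space $\mathbb{R}z\oplus B\oplus\mathbb{R}\bar z$ with the inner product extending $\langle\,,\,\rangle_0$ for which $\mathrm{span}\{z,\bar z\}$ and $B$ are orthogonal, $\langle z,z\rangle=\langle\bar z,\bar z\rangle=0$, $\langle z,\bar z\rangle=1$, and with the bracket $$[\bar z,z]=\mu z,\quad [\bar z,a]=D(a)-\langle b_0,a\rangle_0 z,\quad [a,b]=[a,b]_0+\langle(\xi-\xi^* )(a),b\rangle_0 z\qquad(a,b\in B),$$ where $\xi^*$ is the adjoint of $\xi$ with respect to $\langle\,,\,\rangle_0$; this is a pseudo-Riemannian flat Lie algebra. A pseudo-Riemannian Lie algebra ''is a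 double extension'' if it is isomorphic, by an isometric Lie algebra isomorphism, to one of this form. *)

(* Defs.v *)
From HB Require Import structures.
From mathcomp Require Import all_boot all_order all_algebra.
From mathcomp Require Import all_classical all_reals all_analysis.
From mathcomp Require Import ring.

Set Implicit Arguments.
Unset Strict Implicit.
Unset Printing Implicit Defensive.

Import Order.TTheory GRing.Theory Num.Theory.
Import numFieldNormedType.Exports.

Local Open Scope classical_set_scope.
Local Open Scope ring_scope.

(** * Pseudo-Riemannian Lie algebras *)

Record prLieAlgebra (R : realType) := PRLieAlgebra {
  lie_space :> vectType R;
  lie_br : {bilinear lie_space -> lie_space -> lie_space};
  lie_ip : {symmetric lie_space};
  lie_br_alt : forall u, lie_br u u = 0;
  lie_br_jacobi : forall u v w,
    lie_br u (lie_br v w) + lie_br v (lie_br w u) + lie_br w (lie_br u v) = 0;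
  lie_ip_nondegenerate : nondegenerate lie_ip
}.

Section LieAlgebra.
Variables (R : realType) (g : prLieAlgebra R).
Implicit Types (u v w : g) (f : 'End(g)).
Local Notation br := (lie_br g).
Local Notation ip := (lie_ip g).

Definition riemannian : Prop := forall u, u != 0 -> 0 < ip u u.

(* signature (-,+,...,+), in terms of an orthonormal basis *)
Definition lorentzian : Prop :=
  exists (n : nat) (e : n.+1.-tuple g), basis_of fullv e /\
    forall i j : 'I_n.+1,
      ip e`_i e`_j = if i == j then (if i == ord0 then -1 else 1) else 0.

Definition lie_center : set g := [set z | forall u, br z u = 0].

Definition degenerate_on (W : set g) : Prop :=
  exists z, [/\ W z, z != 0 & forall w, W w -> ip z w = 0].

(* the vector representing a linear form; lie_rieszP and lie_ip_inj show that
   it exists and is unique *)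
Definition lie_riesz (phi : g -> R) : g :=
  xget 0 [set p | forall w, ip p w = phi w].

Lemma lie_ip_inj u v : (forall w, ip u w = ip v w) -> u = v.
Proof.
move=> uv; apply/eqP; rewrite -subr_eq0 -memv0.
rewrite -(eqP (lie_ip_nondegenerate g)).
by apply/mem_orthovP => w _; rewrite linearBl /= uv subrr.
Qed.

Lemma lie_rieszP (phi : {linear g -> R^o}) w : ip (lie_riesz phi) w = phi w.
Proof.
suff [p pP] : exists p, forall v, ip p v = phi v.
  exact: (@xgetI _ (0 : g) [set q | forall v, ip q v = phi v] p pP w).
pose F (p : g) : 'Hom(g, R^o) := linfun (ip p : g -> R^o).
have F_linear : linear F.
  move=> a u v; apply/lfunP => x.
  by rewrite /F !lfunE /= ?lfunE /= ?lfunE /= linearPl.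
pose FL : {linear g -> 'Hom(g, R^o)} :=
  HB.pack F (GRing.isLinear.Build _ _ _ _ F F_linear).
have F_inj : lker (linfun FL) == 0%VS.
  apply/lker0P => u v; rewrite !lfunE => /lfunP uv.
  by apply: lie_ip_inj => x; have := uv x; rewrite !lfunE.
have dimF : \dim (limg (linfun FL)) = \dim {:g}.
  by apply: limg_dim_eq; rewrite (eqP F_inj) capv0.
have : (limg (linfun FL) == {: 'Hom(g, R^o)})%VS.
  by rewrite eqEdim subvf /= dimF !dimvf -[leqRHS]muln1 leqnn.
move=> /eqP imF; have : linfun phi \in limg (linfun FL) by rewrite imF memvf.
move=> /memv_imgP[p _ phiE]; exists p => v.
by have := congr1 (fun h : 'Hom(g, R^o) => h v) phiE; rewrite !lfunE.
Qed.

(* the Levi-Civita product u v, given by Koszul's formula *)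
Definition lc u v : g :=
  lie_riesz (fun w => 2%:R^-1 * (ip (br u v) w + ip (br w u) v + ip (br w v) u)).

Lemma lcP u v w :
  2%:R * ip (lc u v) w = ip (br u v) w + ip (br w u) v + ip (br w v) u.
Proof.
pose phi (x : g) : R^o :=
  2%:R^-1 * (ip (br u v) x + ip (br x u) v + ip (br x v) u).
have phi_linear : linear phi.
  move=> a x y; rewrite /phi !linearPr /= !linearPl /= /GRing.scale.
  by rewrite /=; ring.
have := lie_rieszP (HB.pack phi (GRing.isLinear.Build _ _ _ _ phi phi_linear)) w.
rewrite /lc => -> /=.
by rewrite /phi mulrA divff ?mul1r // pnatr_eq0.
Qed.

Definition adjoint f u : g := lie_riesz (fun w => ip u (f w)).

Lemma adjointP f u w : ip (adjoint f u) w = ip u (f w).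
Proof.
pose phi (x : g) : R^o := ip u (f x).
have phi_linear : linear phi by move=> a x y; rewrite /phi linearP linearPr.
exact: (lie_rieszP (HB.pack phi (GRing.isLinear.Build _ _ _ _ phi phi_linear)) w).
Qed.

Definition flat : Prop := forall u v w,
  lc (br u v) w = lc u (lc v w) - lc v (lc u w).

Definition lfun_trace f : R := \tr (passmx.mxof (vbasis {:g}) (vbasis {:g}) f).

Definition unimodular : Prop := forall u, lfun_trace (linfun (br u)) = 0.

Definition skew_symmetric_lfun f : Prop := forall u v, ip (f u) v = - ip u (f v).

End LieAlgebra.

Arguments lie_center {R} g.

(** * Admissible tuples and double extensions *)

Section DoubleExtension.
Variables (R : realType) (B : prLieAlgebra R).
Variables (xi D : 'End(B)) (mu : R) (b0 : B).
Local Notation br := (lie_br B).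
Local Notation ip := (lie_ip B).

Definition admissible : Prop :=
  [/\ forall a b, xi (br a b) = lc a (xi b) - lc b (xi a),
      forall a b, D (br a b) = br (D a) b + br a (D b)
    & [/\ skew_symmetric_lfun (D - xi),
          forall a, D (xi a) - xi (D a) = xi (xi a) - mu *: xi a - lc a b0
        & forall a b,
            lc a (xi b) - xi (lc a b) = lc (D a) b + lc a (D b) - D (lc a b)]].

(* (s, a, t) stands for s z + a + t zbar *)
Definition dext_space : vectType R := (R^o * B * R^o)%type.

Definition dext_ip (x y : dext_space) : R :=
  let: (s, a, t) := x in let: (s', a', t') := y in
  s * t' + t * s' + ip a a'.

(* the alternating bilinear extension of [zbar, z] = mu z,
   [zbar, a] = D a - <b0, a> z, [a, b] = [a, b]_0 + <(xi - xi^* ) a, b> z *)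
Definition dext_br (x y : dext_space) : dext_space :=
  let: (s, a, t) := x in let: (s', a', t') := y in
  (mu * (t * s' - t' * s) - (t * ip b0 a' - t' * ip b0 a)
     + ip (xi a - adjoint xi a) a',
   t *: D a' - t' *: D a + br a a',
   0).

Definition is_double_extension (g : prLieAlgebra R) : Prop :=
  exists f : 'Hom(g, dext_space),
    [/\ bijective f,
        forall u v, f (lie_br g u v) = dext_br (f u) (f v)
      & forall u v, dext_ip (f u) (f v) = lie_ip g u v].

End DoubleExtension.

(** * Lie groups *)

Section Smooth.
Variables (R : realType) (V W : normedModType R).

Fixpoint Ck (k : nat) (U : set V) (f : V -> W) : Prop :=
  match k with
  | 0 => forall x, U x -> {for x, continuous f}
  | k'.+1 => (forall x, U x -> differentiable f x) /\
             (forall v, Ck k' U (fun x => 'D_v f x))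
  end.

Definition smooth (U : set V) (f : V -> W) : Prop := forall k, Ck k U f.

End Smooth.

HB.mixin Record Group_Topological_isTopologicalGroup G
    of Group G & Topological G := {
  mulg_continuous : continuous (fun p : G * G => (p.1 * p.2)%g);
  invg_continuous : continuous (fun x : G => (x^-1)%g)
}.

#[short(type="topologicalGroupType")]
HB.structure Definition TopologicalGroup :=
  {G of Group_Topological_isTopologicalGroup G & Group G & Topological G}.

Record chart (R : realType) (n : nat) (G : topologicalType) := Chart {
  chart_dom : set G;
  chart_map :> G -> 'rV[R]_n;
  chart_inv : 'rV[R]_n -> G;
  chart_dom_open : open chart_dom;
  chart_img_open : open (chart_map @` chart_dom);
  chart_mapK : forall x, chart_dom x -> chart_inv (chart_map x) = x;
  chart_map_continuous :
    forall x, chart_dom x -> {for x, continuous chart_map};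
  chart_inv_continuous :
    forall y, (chart_map @` chart_dom) y -> {for y, continuous chart_inv}
}.

Definition chart_img (R : realType) n (G : topologicalType)
  (c : chart R n G) : set 'rV[R]_n := c @` chart_dom c.

Record lieGroup (R : realType) (n : nat) := LieGroup {
  lie_group :> topologicalGroupType;
  lie_group_hausdorff : hausdorff_space lie_group;
  lie_group_second_countable : @second_countable lie_group;
  atlas : set (chart R n lie_group);
  atlas_cover : forall x : lie_group, exists2 c, atlas c & chart_dom c x;
  atlas_smooth : forall c d, atlas c -> atlas d ->
    smooth [set x | chart_img c x /\ chart_dom d (chart_inv c x)]
      (fun x => d (chart_inv c x));
  lie_mul_smooth : forall c d e, atlas c -> atlas d -> atlas e ->
    smooth
      [set p | [/\ chart_img c p.1, chart_img d p.2
                 & chart_dom e (chart_inv c p.1 * chart_inv d p.2)%g]]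
      (fun p : 'rV[R]_n * 'rV[R]_n =>
         e (chart_inv c p.1 * chart_inv d p.2)%g);
  lie_inv_smooth : forall c d, atlas c -> atlas d ->
    smooth [set x | chart_img c x /\ chart_dom d ((chart_inv c x)^-1)%g]
      (fun x => d ((chart_inv c x)^-1)%g)
}.

Section LieGroup.
Variables (R : realType) (n : nat) (G : lieGroup R n).

(* A chart c at 1 identifies the tangent space of G at 1 with 'rV_n. This is
   the left-invariant vector field with value u at 1, read in c. *)
Definition left_field (c : chart R n G) (u : 'rV[R]_n) : 'rV[R]_n -> 'rV[R]_n :=
  fun x => 'D_u (fun y => c (chart_inv c x * chart_inv c y)%g) (c 1%g).

Definition field_bracket (X Y : 'rV[R]_n -> 'rV[R]_n) : 'rV[R]_n -> 'rV[R]_n :=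
  fun x => 'D_(X x) Y x - 'D_(Y x) X x.

(* i identifies the Lie algebra g with the Lie algebra of G, the tangent space
   at 1 with the bracket of left-invariant vector fields *)
Definition lie_algebra_of (c : chart R n G) (g : prLieAlgebra R)
    (i : 'Hom(g, 'rV[R]_n)) : Prop :=
  [/\ atlas c, chart_dom c 1%g, bijective i
    & forall u v, i (lie_br g u v) =
        field_bracket (left_field c (i u)) (left_field c (i v)) (c 1%g)].

(* gamma : R -> G is differentiable and x t in g is its velocity at time t,
   translated to the tangent space at 1 by the left translation by
   (gamma t)^-1 *)
Definition left_velocity (c : chart R n G) (g : prLieAlgebra R)
    (i : 'Hom(g, 'rV[R]_n)) (gamma : R -> G) (x : R -> g) : Prop :=
  continuous gamma /\
  forall t : R, is_derive (0 : R) 1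
    (fun h : R => c ((gamma t)^-1 * gamma (t + h)%R)%g) (i (x t)).

(* The left-invariant metric on G with value lie_ip at 1 has the left-invariant
   Levi-Civita connection given by nabla_u v = lc u v on left-invariant vector
   fields; in the left-invariant trivialisation of TG, the covariant derivative
   along gamma of a vector field y is therefore y' + lc x y, x being the
   velocity of gamma. A geodesic is a curve whose velocity is parallel. *)
Definition geodesic (c : chart R n G) (g : prLieAlgebra R)
    (i : 'Hom(g, 'rV[R]_n)) (gamma : R -> G) (x : R -> g) : Prop :=
  left_velocity c i gamma x /\
  forall t : R, is_derive t 1 (fun s : R => i (x s)) (i (- lc (x t) (x t))).

Definition geodesically_complete (c : chart R n G) (g : prLieAlgebra R)
    (i : 'Hom(g, 'rV[R]_n)) : Prop :=
  forall (p : G) (u : g), exists (gamma : R -> G) (x : R -> g),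
    [/\ geodesic c i gamma x, gamma 0 = p & x 0 = u].

End LieGroup.

(* Lie groups with Lie algebra g exist by Lie's third theorem and are locally
   isometric; whether they are complete does not depend on the choice of one. *)
Definition complete_metric (R : realType) (g : prLieAlgebra R) : Prop :=
  forall (n : nat) (G : lieGroup R n) (c : chart R n G)
    (i : 'Hom(g, 'rV[R]_n)),
  lie_algebra_of c i -> geodesically_complete c i.

(* Main.v *)
Require Import Defs.
From HB Require Import structures.
From mathcomp Require Import all_boot all_order all_algebra.
From mathcomp Require Import all_classical all_reals all_analysis.
From mathcomp Require Import ring lra.

(** A degenerate center of a Lorentzian Lie algebra g contains a nonzero
    isotropic vector z orthogonal to the whole center.

    If g is flat, then left multiplication L_z commutes with every L_u because
    [z, u] = 0, and L_z u = L_u z; hence L_z squares to u |-> u (z z) = 0. As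
    L_z is skew, its image is totally isotropic, so of dimension at most one in
    Lorentzian signature, and a skew operator has no rank one image: L_z = 0
    ([flat_central_isotropic_lc]). So z is orthogonal to g g and to [g, g].
    Choosing an isotropic partner zb with <z, zb> = 1 splits g as
    R z + B + R zb with B positive definite; the product of g, projected to B,
    makes B a flat Riemannian Lie algebra, and xi a = - pr (a zb),
    D a = pr [zb, a], b0 = pr (zb zb). The admissibility conditions are the
    B-components of flatness, together with the Jacobi identity. If D and b0
    both vanished, zb would be central, against <z, zb> = 1.

    For the converse, Koszul's formula yields the product of a double extension
    in the coordinates (s, a, t), see [dext_lc]. The B-component of the
    curvature vanishes by admissibility and its zb-component is always 0; the
    remaining z-component vanishes because the curvature operators are skew
    ([dext_flat]).

    Unimodularity. Flatness says R_(v u) = R_u R_v + [L_v, R_u], so that, with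
    R_u v = v u, tr (R_u^k R_v) = tr R_(R_u^k v). Let H represent the form
    u |-> tr R_u = - tr (ad u). Then <H, u v> = tr (R_v R_u) is symmetric in u and
    v, which gives H H = 0, so that tr R_H^k = 0 for all k >= 2; an operator with this property has
    trace 0 ([mxtrace_power_sums]), that is <H, H> = 0. As H is also orthogonal
    to z, it is a multiple of z. Since z is orthogonal to every product, now
    tr R_u^k = 0 for all k >= 2 and all u, and again tr R_u = 0.

    Completeness is read off the double extension. The velocity
    x = s z + a + t zb of a geodesic obeys x' = - x x: its t is constant, |a|^2
    satisfies a linear differential inequality since a a and (D - xi) a drop out
    of <a', a>, and s' is bounded in terms of |a|^2. Hence velocities stay
    bounded on bounded times ([dext_velocity_bounded]). On the group, the
    velocity and the point of a geodesic near 1 solve, in a chart, a system whose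
    right-hand side is Lipschitz on a box. Cutting that side off by clamping the
    coordinates makes it globally bounded and Lipschitz, and Picard iteration
    solves it for a time that depends only on a bound of the initial velocity
    ([local_geodesic]). Left translations carry these pieces anywhere on the
    group, so a geodesic with bounded velocity can always be prolonged by a fixed
    amount of time. *)

Set Implicit Arguments.
Unset Strict Implicit.
Unset Printing Implicit Defensive.

Import Order.TTheory GRing.Theory Num.Theory.
Import numFieldNormedType.Exports.

Local Open Scope classical_set_scope.
Local Open Scope ring_scope.

(** * The Levi-Civita product and Lorentzian geometry *)

Section LeviCivita.
Variables (R : realType) (g : prLieAlgebra R).
Implicit Types (u v w z : g) (a : R).
Local Notation br := (lie_br g).
Local Notation ip := (lie_ip g).

Lemma ipC u v : ip u v = ip v u.
Proof. by rewrite hermC /= expr0 mul1r. Qed.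
Lemma ipDl u v w : ip (u + v) w = ip u w + ip v w.
Proof. by rewrite linearDl. Qed.
Lemma ipDr u v w : ip w (u + v) = ip w u + ip w v.
Proof. by rewrite linearDr. Qed.
Lemma ipZl a u w : ip (a *: u) w = a * ip u w.
Proof. by rewrite linearZl_LR. Qed.
Lemma ipZr a u w : ip w (a *: u) = a * ip w u.
Proof. by rewrite linearZr_LR. Qed.
Lemma ipNl u w : ip (- u) w = - ip u w.
Proof. by rewrite linearNl. Qed.
Lemma ipNr u w : ip w (- u) = - ip w u.
Proof. by rewrite linearNr. Qed.
Lemma ip0l w : ip 0 w = 0.
Proof. by rewrite linear0l. Qed.
Lemma ip0r w : ip w 0 = 0.
Proof. by rewrite linear0r. Qed.
Lemma ip_suml I (r : seq I) P (F : I -> g) w :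
  ip (\sum_(i <- r | P i) F i) w = \sum_(i <- r | P i) ip (F i) w.
Proof. by apply: (big_morph (ip ^~ w)) => [u v|]; rewrite ?ipDl ?ip0l. Qed.
Lemma ip_sumr I (r : seq I) P (F : I -> g) w :
  ip w (\sum_(i <- r | P i) F i) = \sum_(i <- r | P i) ip w (F i).
Proof. by rewrite ipC ip_suml; apply: eq_bigr => i _; rewrite ipC. Qed.
Definition ipE := (ipDl, ipDr, ipNl, ipNr, ipZl, ipZr, ip0l, ip0r).

Lemma brDl u v w : br (u + v) w = br u w + br v w.
Proof. by rewrite linearDl. Qed.
Lemma brDr u v w : br w (u + v) = br w u + br w v.
Proof. by rewrite linearDr. Qed.
Lemma brZl a u w : br (a *: u) w = a *: br u w.
Proof. by rewrite linearZl_LR. Qed.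
Lemma brZr a u w : br w (a *: u) = a *: br w u.
Proof. by rewrite linearZr_LR. Qed.
Lemma brC u v : br u v = - br v u.
Proof.
apply/eqP; rewrite -subr_eq0 opprK; apply/eqP.
have := lie_br_alt (u + v).
by rewrite brDl !brDr !lie_br_alt addr0 add0r.
Qed.

(** Koszul's formula determines the product because the form is nondegenerate. *)
Lemma lc_def u v p :
  (forall w, 2%:R * ip p w = ip (br u v) w + ip (br w u) v + ip (br w v) u) ->
  lc u v = p.
Proof.
move=> H; apply: lie_ip_inj => w.
by apply: (mulfI (_ : 2%:R != 0 :> R)); rewrite ?pnatr_eq0// lcP H.
Qed.

Lemma lc_torsion u v : lc u v - lc v u = br u v.
Proof.
apply: lie_ip_inj => w; apply: (mulfI (_ : 2%:R != 0 :> R)); rewrite ?pnatr_eq0//.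
rewrite !ipE mulrDr mulrN !lcP (brC v u) !ipE; ring.
Qed.

Lemma lc_skew u v w : ip (lc u v) w = - ip v (lc u w).
Proof.
apply: (mulfI (_ : 2%:R != 0 :> R)); rewrite ?pnatr_eq0//.
rewrite mulrN (ipC v) !lcP (brC v w) (brC v u) (brC u w) !ipE; ring.
Qed.

Lemma lc_skewC u v w : ip v (lc u w) = - ip (lc u v) w.
Proof. by rewrite lc_skew opprK. Qed.

Lemma lc_skew0 u v : ip (lc u v) v = 0.
Proof. by have := lc_skew u v v; rewrite (ipC v) => h; lra. Qed.

Lemma lcDl u v w : lc (u + v) w = lc u w + lc v w.
Proof.
by apply: lc_def => x; rewrite !(brDl, brDr, ipE) mulrDr !lcP; ring.
Qed.
Lemma lcDr u v w : lc w (u + v) = lc w u + lc w v.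
Proof.
by apply: lc_def => x; rewrite !(brDl, brDr, ipE) mulrDr !lcP; ring.
Qed.
Lemma lcZl a u w : lc (a *: u) w = a *: lc u w.
Proof.
by apply: lc_def => x; rewrite !(brZl, brZr, ipE) mulrCA !lcP; ring.
Qed.
Lemma lcZr a u w : lc w (a *: u) = a *: lc w u.
Proof.
by apply: lc_def => x; rewrite !(brZl, brZr, ipE) mulrCA !lcP; ring.
Qed.
Lemma lcNl u w : lc (- u) w = - lc u w.
Proof. by rewrite -scaleN1r lcZl scaleN1r. Qed.
Lemma lcNr u w : lc w (- u) = - lc w u.
Proof. by rewrite -scaleN1r lcZr scaleN1r. Qed.
Lemma lc0l w : lc 0 w = 0.
Proof. by have := lcZl 0 0 w; rewrite !scale0r. Qed.
Lemma lc0r w : lc w 0 = 0.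
Proof. by have := lcZr 0 0 w; rewrite !scale0r. Qed.
Definition lcE := (lcDl, lcDr, lcNl, lcNr, lcZl, lcZr, lc0l, lc0r).

End LeviCivita.

Section Lorentz.
Variables (R : realType) (g : prLieAlgebra R).
Implicit Types (u v w z : g) (a : R).
Local Notation br := (lie_br g).
Local Notation ip := (lie_ip g).

(** In Lorentzian signature this holds for every timelike e0. *)
Definition positive_on_perp e0 := forall w, ip w e0 = 0 -> w != 0 -> 0 < ip w w.

Lemma lorentzian_positive_on_perp : lorentzian g -> exists e0, positive_on_perp e0.
Proof.
move=> [n [e [be he]]]; exists e`_0 => w w0 wN0.
have ipcoord v (j : 'I_n.+1) :
    ip v e`_j = coord e j v * (if j == ord0 then -1 else 1).
  rewrite {1}(coord_basis be (memvf v)) ip_suml (bigD1 j)//= big1 ?addr0.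
    by rewrite ipE he eqxx.
  by move=> i /negPf ij; rewrite ipE he ij mulr0.
have c0 : coord e ord0 w = 0.
  have := ipcoord w ord0; rewrite w0 eqxx mulrN1 => /esym/eqP.
  by rewrite oppr_eq0 => /eqP.
have ipww : ip w w = \sum_i coord e i w ^+ 2.
  rewrite {2}(coord_basis be (memvf w)) ip_sumr; apply: eq_bigr => i _.
  rewrite ipE ipcoord; case: eqP => [->|_]; last by rewrite mulr1 expr2.
  by rewrite c0 !mul0r expr2 mul0r.
rewrite ipww lt_neqAle sumr_ge0 ?andbT; last by move=> i _; exact: sqr_ge0.
apply: contra wN0; rewrite eq_sym psumr_eq0; last by move=> i _; exact: sqr_ge0.
move=> /allP H; rewrite (coord_basis be (memvf w)) big1// => i _.
have := H i; rewrite mem_index_enum sqrf_eq0 => /(_ isT)/eqP ->.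
by rewrite scale0r.
Qed.

Section PositiveOnPerp.
Variable e0 : g.
Hypothesis e0P : positive_on_perp e0.

Lemma isotropic_time_neq0 z : z != 0 -> ip z z = 0 -> ip z e0 != 0.
Proof. by move=> z0 zz; apply/eqP => /e0P/(_ z0); rewrite zz ltxx. Qed.

(** Subtracting from u the multiple of z that makes it orthogonal to e0 changes
    neither its square norm nor its nonvanishing. *)
Lemma perp_isotropic_pos z u : z != 0 -> ip z z = 0 -> ip u z = 0 ->
  (forall k, u != k *: z) -> 0 < ip u u.
Proof.
move=> z0 zz uz uk; have ze0 := isotropic_time_neq0 z0 zz.
pose k := ip u e0 / ip z e0.
have -> : ip u u = ip (u - k *: z) (u - k *: z).
  by rewrite !ipE zz uz (ipC z u) uz; ring.
apply: e0P; last by rewrite subr_eq0.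
by rewrite !ipE /k divfK// subrr.
Qed.

Lemma isotropic_perp_collinear z u : z != 0 -> ip z z = 0 -> ip u z = 0 ->
  ip u u = 0 -> exists k, u = k *: z.
Proof.
move=> z0 zz uz uu; apply: contrapT => H.
have : 0 < ip u u.
  by apply: (perp_isotropic_pos z0 zz uz) => k; apply/eqP => uk; apply: H; exists k.
by rewrite uu ltxx.
Qed.

(** L_z has square zero since it commutes with every L_u and z z = 0; being skew,
    it then has a totally isotropic image, hence rank at most one, which is
    impossible for a nonzero skew operator. *)
Lemma flat_central_isotropic_lc z : flat g -> lie_center g z -> ip z z = 0 ->
  forall u, lc z u = 0.
Proof.
move=> fg zc zz.
have lczC u : lc u z = lc z u.
  by apply/eqP; rewrite eq_sym -subr_eq0 lc_torsion zc.
have comm u v : lc z (lc u v) = lc u (lc z v).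
  by apply/eqP; rewrite -subr_eq0 -fg zc lc0l.
have zz0 : lc z z = 0.
  apply: lie_ip_inj => w; rewrite ip0l lc_skew.
  by apply/eqP; rewrite oppr_eq0 -lczC ipC lc_skew0.
have sq u : lc z (lc z u) = 0 by rewrite -(lczC u) comm zz0 lc0r.
have iso u v : ip (lc z u) (lc z v) = 0 by rewrite lc_skew sq ipE oppr0.
move=> u; apply/eqP; apply/negPn/negP => zu0.
have [v0 v0P] : exists v, ip (lc z u) v != 0.
  apply: contrapT => H; move/eqP: zu0; apply; apply: lie_ip_inj => w.
  rewrite ip0l; apply/eqP/negPn/negP => ?; apply: H; by exists w.
(* z v is collinear to z u, say z v = k (z u), and <z v, v> = 0 *)
have col v : ip (lc z u) v != 0 -> lc z v = 0.
  have [k kE] := isotropic_perp_collinear zu0 (iso _ _) (iso v u) (iso v v).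
  move=> vN0; have := lc_skew0 z v; rewrite kE ipE => /eqP.
  by rewrite mulf_eq0 (negPf vN0) orbF => /eqP ->; rewrite scale0r.
have uv0 : ip (lc z u) (u + v0) != 0 by rewrite ipDr lc_skew0 add0r.
by move: (col _ uv0) zu0; rewrite lcDr (col _ v0P) addr0 => ->; rewrite eqxx.
Qed.

End PositiveOnPerp.
End Lorentz.

(** * Traces and unimodularity *)

Section PowerSums.
Variable F : numFieldType.

Lemma mxtrace_horner_ge2 n (A : 'M[F]_n.+1) (r : {poly F}) k :
  (forall j, (2 <= j)%N -> \tr (A ^+ j) = 0) -> (2 <= k)%N ->
  \tr (A ^+ k *m horner_mx A r) = 0.
Proof.
move=> trA; elim/poly_ind: r k => [|r c ih] k k2.
  by rewrite rmorph0 mulmx0 mxtrace0.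
rewrite rmorphD rmorphM /= horner_mx_X horner_mx_C mulmxDr mxtraceD.
rewrite mul_mx_scalar mxtraceZ trA// mulr0 addr0.
have := ih k.+1 (leqW k2); rewrite exprSr => <-.
rewrite -!mulmxE -!mulmxA; congr (\tr (_ *m _)).
by rewrite mulmxE -{2 3}(horner_mx_X A) -!rmorphM /= mulrC.
Qed.

(** By induction on the size. If A is invertible and p is its characteristic
    polynomial, then p (p_0 - p_1 X) kills A and has constant term p_0^2 != 0
    and no linear term; its trace would be p_0^2 n. Otherwise A = C R through
    the smaller rank of A, and R C has the same traces of powers. *)
Lemma mxtrace_power_sums n (A : 'M[F]_n) :
  (forall k, (2 <= k)%N -> \tr (A ^+ k) = 0) -> \tr A = 0.
Proof.
elim/ltn_ind: n A => -[|n] ih A trA; first by rewrite /mxtrace big_ord0.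
have [Au|Au] := boolP (A \in unitmx).
  pose p := char_poly A.
  (* the second factor is chosen to cancel the linear coefficient *)
  pose q := p * ((p`_0)%:P - p`_1 *: 'X).
  have q0 : q`_0 = p`_0 ^+ 2.
    by rewrite coef0M !coefE /= mulr0 subr0 expr2.
  have q1 : q`_1 = 0.
    rewrite coefM big_ord_recr big_ord_recr big_ord0 /= !coefE /=; ring.
  have qA : horner_mx A q = 0 by rewrite rmorphM /= Cayley_Hamilton mul0r.
  have qE : q = (q`_0)%:P + 'X^2 * drop_poly 2 q.
    rewrite -[LHS](poly_take_drop 2) mulrC; congr (_ + _).
    apply/polyP => i; rewrite coef_take_poly coefC.
    by case: i => [|[|i]]//=; rewrite q1.
  have : \tr (horner_mx A q) = q`_0 *+ n.+1.
    rewrite {1}qE rmorphD rmorphM /= rmorphXn /= horner_mx_X horner_mx_C mxtraceD.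
    by rewrite mxtrace_scalar mxtrace_horner_ge2// addr0.
  rewrite qA mxtrace0 q0 => /esym/eqP; rewrite mulrn_eq0 /= sqrf_eq0 char_poly_det.
  rewrite mulf_eq0 signr_eq0 /= => /eqP d0.
  by move: Au; rewrite unitmxE d0 unitr0.
have rA : (\rank A < n.+1)%N.
  by rewrite ltn_neqAle rank_leq_row andbT -/(row_free A) row_free_unit.
pose A' := row_base A *m col_base A.
have powA k : A ^+ k.+1 = col_base A *m A' ^+ k *m row_base A.
  elim: k => [|k ihk]; first by rewrite expr1 expr0 mulmx1 mulmx_base.
  rewrite exprSr ihk -mulmxE exprSr -mulmxE -[X in _ *m X = _]mulmx_base /A'.
  by rewrite !mulmxA.
have trpow k : \tr (A ^+ k.+1) = \tr (A' ^+ k.+1).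
  by rewrite powA mxtrace_mulC mulmxA exprS.
rewrite -[A]expr1 trpow expr1; apply: ih => // -[|k] k2//.
by rewrite -trpow trA.
Qed.
End PowerSums.

Section Linhom.
Variables (F : fieldType) (U V : vectType F) (f : U -> V) (f_lin : linear f).

Definition linhom : 'Hom(U, V) :=
  linfun (HB.pack f (GRing.isLinear.Build _ _ _ _ f f_lin) : {linear U -> V}).

Lemma linhomE x : linhom x = f x.
Proof. by rewrite lfunE. Qed.
End Linhom.

Section Trace.
Variables (R : realType) (g : prLieAlgebra R).
Implicit Types (u v w z : g) (f h : 'End(g)).
Local Notation br := (lie_br g).
Local Notation ip := (lie_ip g).
Local Notation b := (vbasis {:g}).
Local Notation mx := (passmx.mxof b b).
Local Notation tr := (@lfun_trace R g).

Lemma vbasis_full : basis_of {:g} b. Proof. exact: vbasisP. Qed.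

Definition gram : 'M[R]_(\dim {:g}) := \matrix_(i, j) ip b`_i b`_j.

Lemma mul_gram (u : 'rV[R]_(\dim {:g})) j :
  (u *m gram) 0 j = ip (passmx.vecof b u) b`_j.
Proof.
by rewrite mxE ip_suml; apply: eq_bigr => i _; rewrite mxE ipE.
Qed.

Lemma gram_unit : gram \in unitmx.
Proof.
rewrite -row_free_unit -kermx_eq0; apply/rowV0P => u /sub_kermxP uG.
apply/eqP; rewrite -(passmx.vecof_eq0 vbasis_full); apply/eqP.
apply: lie_ip_inj => w; rewrite ip0l (coord_vbasis (memvf w)) ip_sumr big1//.
by move=> i _; rewrite ipE -mul_gram uG mxE mulr0.
Qed.

(** With G the Gram matrix, the matrix M of f satisfies M G = - G M^T. *)
Lemma skew_trace0 f : skew_symmetric_lfun f -> tr f = 0.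
Proof.
move=> skewf; have G := gram_unit.
have mxG i j : (mx f *m gram) i j = ip (f b`_i) b`_j.
  have := mul_gram (row i (mx f)) j; rewrite -row_mul mxE => ->.
  by rewrite rowE -(passmx.hom_vecof _ vbasis_full) passmx.vecof_delta.
have skewG : mx f *m gram = - (gram *m (mx f)^T).
  have gramT : gram^T = gram by apply/matrixP => i j; rewrite !mxE ipC.
  rewrite -{2}gramT -trmx_mul; apply/matrixP => i j.
  by rewrite [RHS]mxE [in RHS]mxE !mxG skewf ipC.
have : \tr (mx f) = - \tr (mx f).
  rewrite -{1}(mulmxK G (mx f)) skewG mulNmx raddfN /= mxtrace_mulC.
  by rewrite mulmxA (mulVmx G) mul1mx mxtrace_tr.
by rewrite /lfun_trace => h; lra.
Qed.

Lemma lc_linear u : linear (lc u : g -> g).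
Proof. by move=> a v w; rewrite !lcE. Qed.
Lemma lcr_linear v : linear (fun u : g => lc u v).
Proof. by move=> a u w; rewrite !lcE. Qed.
Definition lcL u : 'End(g) := linhom (lc_linear u).
Definition lcR v : 'End(g) := linhom (lcr_linear v).

Lemma mxofD f h : mx (f + h) = mx f + mx h.
Proof. by have := passmx.mxof_linear b b 1 f h; rewrite !scale1r. Qed.
Lemma mxofB f h : mx (f - h) = mx f - mx h.
Proof.
by have := passmx.mxof_linear b b (-1) h f; rewrite !scaleN1r [f - h]addrC [RHS]addrC.
Qed.

Lemma trace_ad u : tr (linfun (br u)) = - tr (lcR u).
Proof.
have -> : linfun (br u) = lcL u - lcR u.
  by apply/lfunP => v; rewrite !lfunE /= !lfunE /= !linhomE lc_torsion.
rewrite /lfun_trace mxofB raddfB /= -/(lfun_trace (lcL u)) skew_trace0 ?sub0r//.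
by move=> v w; rewrite !linhomE lc_skew.
Qed.

Section Flat.
Hypothesis fg : flat g.

(** Flatness in terms of right multiplications, R_(v u) = R_u R_v + [L_v, R_u];
    row vectors reverse the order of composition. *)
Lemma flat_lcR v u : mx (lcR (lc v u)) =
  mx (lcR v) *m mx (lcR u) - mx (lcL v) *m mx (lcR u) + mx (lcR u) *m mx (lcL v).
Proof.
have bf := vbasis_full.
rewrite -!(passmx.mxof_comp _ _ bf) -mxofB -mxofD; congr (mx _).
apply/lfunP => w; rewrite !(add_lfunE, opp_lfunE, comp_lfunE, linhomE).
apply: lie_ip_inj => x; have := congr1 (lie_ip g ^~ x) (fg v w u).
by rewrite /= -lc_torsion !lcE !ipE; lra.
Qed.

Definition unimodular_form v : R := tr (lcR v).

Lemma unimodular_form_linear : linear (unimodular_form : g -> R^o).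
Proof.
move=> a u v; rewrite /unimodular_form.
have -> : lcR (a *: u + v) = a *: lcR u + lcR v.
  by apply/lfunP => w; rewrite !lfunE /= !lfunE /= !linhomE !lcE.
by rewrite /lfun_trace passmx.mxof_linear mxtraceD mxtraceZ.
Qed.

(** The commutator term of the previous identity disappears under the trace
    against a power of R_u. *)
Lemma trace_lcR_pow k u v :
  \tr (mx (lcR u) ^+ k *m mx (lcR v)) = unimodular_form (iter k (fun x : g => lc x u) v).
Proof.
elim: k v => [|k ih] v; first by rewrite expr0 mul1mx.
rewrite iterSr -ih flat_lcR mulmxDr mulmxBr raddfD raddfB /=.
have -> : \tr (mx (lcR u) ^+ k *m (mx (lcR u) *m mx (lcL v))) =
          \tr (mx (lcR u) ^+ k *m (mx (lcL v) *m mx (lcR u))).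
  rewrite [in RHS]mxtrace_mulC -[in RHS]mulmxA [RHS]mxtrace_mulC mulmxA.
  by rewrite mulmxE -exprSr exprS.
by rewrite subrK [RHS]mxtrace_mulC -mulmxA [RHS]mxtrace_mulC mulmxE -exprS.
Qed.

Lemma trace_lcR_pow_self k u :
  \tr (mx (lcR u) ^+ k.+1) = unimodular_form (iter k (fun x : g => lc x u) u).
Proof. by rewrite -trace_lcR_pow exprSr. Qed.

(** The vector H representing u |-> tr R_u satisfies H H = 0, so all traces of
    powers R_H^k with k >= 2 vanish and <H, H> = tr R_H = 0. Together with
    <H, z> = 0 this forces H to be a multiple of z, and then the traces of the
    powers of every R_u vanish as well. *)
Lemma flat_unimodular (e0 : g) z : positive_on_perp e0 ->
  z != 0 -> ip z z = 0 -> (forall u, lc u z = 0) -> unimodular g.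
Proof.
move=> e0P z0 zz uz u.
pose T : {linear g -> R^o} :=
  HB.pack unimodular_form (GRing.isLinear.Build _ _ _ _ _ unimodular_form_linear).
pose H := lie_riesz T.
have HP v : ip H v = unimodular_form v by rewrite lie_rieszP.
have HlcC v w : ip H (lc v w) = ip H (lc w v).
  have trC x y : ip H (lc x y) = \tr (mx (lcR y) *m mx (lcR x)).
    by rewrite HP -(trace_lcR_pow 1) expr1.
  by rewrite !trC mxtrace_mulC.
have HH0 : lc H H = 0.
  apply: lie_ip_inj => v; rewrite ip0l lc_skew HlcC ipC lc_skew.
  by rewrite opprK ipC lc_skew0.
have iterHH k : iter k.+1 (fun x : g => lc x H) H = 0.
  by rewrite iterSr HH0; elim: k => // k ih; rewrite iterS ih lc0l.
have HH : ip H H = 0.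
  rewrite HP /unimodular_form /lfun_trace.
  apply: mxtrace_power_sums => -[|[|k]]// _.
  by rewrite trace_lcR_pow_self iterHH -HP ip0r.
have Hz : ip H z = 0.
  rewrite HP /unimodular_form.
  have -> : lcR z = 0 by apply/lfunP => v; rewrite linhomE uz lfunE.
  by apply: skew_trace0 => v w; rewrite !lfunE /= ip0l ip0r oppr0.
have [a Ha] := isotropic_perp_collinear e0P z0 zz Hz HH.
rewrite trace_ad; apply/eqP; rewrite oppr_eq0; apply/eqP; rewrite /lfun_trace.
apply: mxtrace_power_sums => -[|[|k]]// _.
rewrite trace_lcR_pow_self -HP Ha iterS !ipE ipC lc_skew uz ip0r oppr0.
by rewrite mulr0.
Qed.
End Flat.
End Trace.

(** * Double extensions are flat *)

Section HomLin.
Variables (F : fieldType) (U V : vectType F) (f : 'Hom(U, V)).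
Lemma homD u v : f (u + v) = f u + f v. Proof. by rewrite linearD. Qed.
Lemma homN u : f (- u) = - f u. Proof. by rewrite linearN. Qed.
Lemma homZ a u : f (a *: u) = a *: f u. Proof. by rewrite linearZ. Qed.
End HomLin.
Definition hom_linE := (homD, homN, homZ).

Section DoubleExtensionFlat.
Variables (R : realType) (B : prLieAlgebra R) (xi D : 'End(B)) (b0 : B).
Local Notation br := (lie_br B).
Local Notation ip := (lie_ip B).
Local Notation dext := (dext_space B).

(** The Levi-Civita product of the double extension with mu = 0. *)
Definition dext_lc (x y : dext) : dext :=
  let: (s, a, t) := x in let: (s', a', t') := y in
  (ip (xi a) a' - t * ip b0 a',
   lc a a' - t' *: xi a + t *: (D a' - xi a') + (t * t') *: b0,
   0).

Hypothesis Dxi_skew : skew_symmetric_lfun (D - xi).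

Lemma dext_koszul (x y w : dext) :
  2%:R * dext_ip (dext_lc x y) w =
    dext_ip (dext_br xi D 0 b0 x y) w + dext_ip (dext_br xi D 0 b0 w x) y
    + dext_ip (dext_br xi D 0 b0 w y) x.
Proof.
case: x y w => [[s a] t] [[s' a'] t'] [[s'' a''] t''] /=.
have skew u v : ip (D u) v = ip (xi u) v + ip (xi v) u - ip (D v) u.
  have := Dxi_skew u v; rewrite !(add_lfunE, opp_lfunE) !ipE !(ipC u) => h; lra.
have K : ip (br a a') a'' =
    2%:R * ip (lc a a') a'' - ip (br a'' a) a' - ip (br a'' a') a.
  by rewrite lcP; ring.
rewrite !ipE !adjointP !(ipC _ (xi _)) K.
rewrite (skew a'' a') (skew a'' a) (skew a' a).
ring.
Qed.

Variables (g : prLieAlgebra R) (f : 'Hom(g, dext)).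
Hypothesis f_bij : bijective f.
Hypothesis f_br : forall u v, f (lie_br g u v) = dext_br xi D 0 b0 (f u) (f v).
Hypothesis f_ip : forall u v, dext_ip (f u) (f v) = lie_ip g u v.

Lemma dext_lcE u v : f (lc u v) = dext_lc (f u) (f v).
Proof.
have [h hK fK] := f_bij; rewrite -[RHS]fK; congr (f _); apply: lc_def => w.
by rewrite -!f_ip !f_br fK dext_koszul.
Qed.

(** The curvature K u v has values in R z: its B-component is what the
    admissibility conditions and the flatness of B cancel. Being skew, with
    <K u v z', z'> = 0 for z' of coordinates (0, 0, 1), it is then zero. *)
Lemma dext_flat : flat B -> admissible xi D 0 b0 -> flat g.
Proof.
move=> fB [adm1 _ [_ adm2 adm3]].
have lcb0 a : lc a b0 = xi (xi a) - D (xi a) + xi (D a).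
  apply: lie_ip_inj => y; have := congr1 (ip ^~ y) (adm2 a).
  by rewrite /= scale0r subr0 !ipE => h; lra.
have lcD a b : lc (D a) b = lc a (xi b) - xi (lc a b) - lc a (D b) + D (lc a b).
  apply: lie_ip_inj => y; have := congr1 (ip ^~ y) (adm3 a b).
  by rewrite /= !ipE => h; lra.
pose K u v w := lc (lie_br g u v) w - (lc u (lc v w) - lc v (lc u w)).
have K_skew u v w y : lie_ip g (K u v w) y = - lie_ip g w (K u v y).
  rewrite /K !ipE !lc_skew (lc_skewC (lie_br g u v)) (lc_skewC u) (lc_skewC v).
  rewrite !lc_skew; lra.
have zline (x : dext) : x.1.2 = 0 -> x.2 = 0 -> exists k, x = (k, 0, 0).
  by case: x => [[k a] t] /= -> ->; exists k.
have fK u v w : exists k, f (K u v w) = (k, 0, 0).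
  rewrite /K !linearB /= !dext_lcE f_br.
  move: (f u) (f v) (f w) => [[s a] t] [[s' a'] t'] [[s'' a''] t''].
  apply: zline; rewrite /= ?subrr ?subr0 ?oppr0 ?addr0//.
  apply: lie_ip_inj => y.
  rewrite !scale0r !(lcE, hom_linE).
  rewrite fB !adm1 !lcD !lcb0 !ipE.
  ring.
have zbar_ex : exists zb, f zb = (0, 0, 1).
  by have [h hK fhK] := f_bij; exists (h (0, 0, 1)); rewrite fhK.
have [zb zbE] := zbar_ex.
have zbK u v w k : f (K u v w) = (k, 0, 0) -> lie_ip g (K u v w) zb = k.
  by move=> Kk; rewrite -f_ip Kk zbE /= ip0l; ring.
move=> u v w; apply/eqP; rewrite -subr_eq0 -/(K u v w); apply/eqP.
have [h hK fhK] := f_bij; apply: (can_inj hK); rewrite linear0.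
have [k kE] := fK u v w; have [k' k'E] := fK u v zb.
have k'0 : k' = 0.
  by have := K_skew u v zb zb; rewrite (ipC zb) (zbK _ _ _ _ k'E) => ?; lra.
rewrite kE; congr (_, _, _).
rewrite -(zbK _ _ _ _ kE) K_skew -f_ip k'E k'0.
by case: (f w) => [[? ?] ?] /=; rewrite ip0r !mulr0 !addr0 oppr0.
Qed.

End DoubleExtensionFlat.

(** * Flatness gives a double extension *)

Section Reduction.
Variables (R : realType) (g : prLieAlgebra R).
Implicit Types (u v w : g).
Local Notation br := (lie_br g).
Local Notation ip := (lie_ip g).
Variables (z zb : g).
Hypotheses (zz : ip z z = 0) (zbzb : ip zb zb = 0) (zzb : ip z zb = 1).
Hypothesis perp_pos : forall u, ip u z = 0 -> ip u zb = 0 -> u != 0 -> 0 < ip u u.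
Hypothesis (z_br : forall u, br z u = 0) (z_lc : forall u, lc z u = 0).

Definition red_space : {vspace g} :=
  (orthov (lie_ip g) <[z]> :&: orthov (lie_ip g) <[zb]>)%VS.
Local Notation B := (subvs_of red_space).

Lemma red_spaceP u : reflect (ip u z = 0 /\ ip u zb = 0) (u \in red_space).
Proof.
by rewrite memv_cap !mem_orthov1; apply: (iffP andP) => [[/eqP -> /eqP ->]|[-> ->]].
Qed.

(** The orthogonal projection on the complement of the hyperbolic plane spanned by
    z and zb. *)
Definition red_proj u : g := u - ip u zb *: z - ip u z *: zb.

Lemma red_proj_in u : red_proj u \in red_space.
Proof.
apply/red_spaceP; rewrite /red_proj !ipE zz zbzb zzb (ipC zb) zzb; split; ring.
Qed.

Lemma red_proj_linear : linear red_proj.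
Proof.
move=> a u v; apply: lie_ip_inj => w; rewrite /red_proj !ipE; ring.
Qed.

Definition red_pr u : B := vsproj red_space (red_proj u).

Lemma val_red_pr u : vsval (red_pr u) = red_proj u.
Proof. by rewrite vsprojK// red_proj_in. Qed.

Lemma red_pr_linear : linear red_pr.
Proof. by move=> a u v; rewrite /red_pr red_proj_linear linearP. Qed.

Lemma red_val (a : B) : ip (vsval a) z = 0 /\ ip (vsval a) zb = 0.
Proof. by apply/red_spaceP; exact: subvsP. Qed.

Definition red_br (a b : B) : B := red_pr (br (vsval a) (vsval b)).
Definition red_ip (a b : B) : R := ip (vsval a) (vsval b).

Lemma red_valP k (a b : B) : vsval (k *: a + b) = k *: vsval a + vsval b.
Proof. by rewrite linearP. Qed.

Lemma red_br_bilinear : bilinear_for *:%R *:%R red_br.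
Proof.
split=> [b|b] k u v; rewrite /red_br red_valP ?(brDl, brDr) ?(brZl, brZr);
  exact: red_pr_linear.
Qed.
HB.instance Definition _ :=
  bilinear_isBilinear.Build R B B B *:%R *:%R red_br red_br_bilinear.

Lemma red_ip_bilinear : bilinear_for *%R (idfun \; *%R) red_ip.
Proof.
by split=> [b|b] k u v; rewrite /red_ip red_valP ?(ipDl, ipDr) ?(ipZl, ipZr).
Qed.
HB.instance Definition _ :=
  bilinear_isBilinear.Build R B B R *%R (idfun \; *%R) red_ip red_ip_bilinear.
Lemma red_ip_sym (u v : B) : red_ip u v = (-1) ^+ false * idfun (red_ip v u).
Proof. by rewrite /red_ip expr0 mul1r ipC. Qed.
HB.instance Definition _ :=
  isHermitianSesquilinear.Build R B false idfun red_ip red_ip_sym.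

Lemma lc_z u : lc u z = 0.
Proof.
by have := lc_torsion u z; rewrite z_lc subr0 brC z_br oppr0.
Qed.

Lemma lc_perp u v : ip (lc u v) z = 0.
Proof. by rewrite lc_skew lc_z ip0r oppr0. Qed.

Lemma br_perp u v : ip (br u v) z = 0.
Proof. by rewrite -lc_torsion !ipE !lc_perp subr0. Qed.

(** On the orthogonal of z the projection only removes a multiple of z, which
    multiplies everything to 0; so products and brackets can be computed before
    projecting. *)
Lemma red_proj_perp u : ip u z = 0 -> red_proj u = u - ip u zb *: z.
Proof. by move=> uz; rewrite /red_proj uz scale0r subr0. Qed.

Lemma lc_projl u v : ip u z = 0 -> lc (red_proj u) v = lc u v.
Proof. by move=> uz; rewrite red_proj_perp// !lcE z_lc scaler0 oppr0 addr0. Qed.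
Lemma lc_projr u v : ip u z = 0 -> lc v (red_proj u) = lc v u.
Proof. by move=> uz; rewrite red_proj_perp// !lcE lc_z scaler0 oppr0 addr0. Qed.
Lemma br_projr u v : ip u z = 0 -> br v (red_proj u) = br v u.
Proof. by move=> uz; rewrite -!lc_torsion lc_projl ?lc_projr. Qed.
Lemma br_projl u v : ip u z = 0 -> br (red_proj u) v = br u v.
Proof. by move=> uz; rewrite -!lc_torsion lc_projl ?lc_projr. Qed.

Lemma red_prD u v : red_pr (u + v) = red_pr u + red_pr v.
Proof. by have := red_pr_linear 1 u v; rewrite !scale1r. Qed.
Lemma red_pr0 : red_pr 0 = 0.
Proof. by apply: (addIr (red_pr 0)); rewrite -red_prD !add0r. Qed.
Lemma red_prN u : red_pr (- u) = - red_pr u.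
Proof. by apply: (addrI (red_pr u)); rewrite -red_prD !subrr red_pr0. Qed.

Lemma red_prZ a u : red_pr (a *: u) = a *: red_pr u.
Proof. by have := red_pr_linear a u 0; rewrite !addr0 red_pr0 addr0. Qed.

Lemma red_br_alt (u : B) : red_br u u = 0.
Proof. by rewrite /red_br lie_br_alt red_pr0. Qed.

Lemma red_br_jacobi (u v w : B) :
  red_br u (red_br v w) + red_br v (red_br w u) + red_br w (red_br u v) = 0.
Proof.
rewrite /red_br !val_red_pr !br_projr ?br_perp//.
by rewrite -!red_prD lie_br_jacobi red_pr0.
Qed.

Lemma red_ip_pos (u : B) : u != 0 -> 0 < red_ip u u.
Proof.
move=> u0; have [uz uzb] := red_val u; exact: perp_pos.
Qed.

Lemma red_ip_nondegenerate : nondegenerate (red_ip : {symmetric B}).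
Proof.
rewrite /nondegenerate -subv0; apply/subvP => u /mem_orthovP H; rewrite memv0.
by apply/negPn/negP => /red_ip_pos; rewrite H ?ltxx// memvf.
Qed.

Definition red_alg : prLieAlgebra R :=
  PRLieAlgebra red_br_alt red_br_jacobi red_ip_nondegenerate.

Lemma red_alg_ipE (a b : red_alg) : lie_ip red_alg a b = red_ip a b.
Proof. by []. Qed.
Lemma red_alg_brE (a b : red_alg) : lie_br red_alg a b = red_br a b.
Proof. by []. Qed.
Definition red_algE := (red_alg_ipE, red_alg_brE).

Lemma red_alg_riemannian : riemannian red_alg.
Proof. exact: red_ip_pos. Qed.

Lemma red_ip_pr u (a : B) : red_ip (red_pr u) a = ip u (vsval a).
Proof.
have [az azb] := red_val a.
rewrite /red_ip val_red_pr /red_proj !ipE ![ip _ (vsval a)]ipC az azb (ipC u).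
by ring.
Qed.

Lemma red_ip_prr u (a : B) : red_ip a (red_pr u) = ip (vsval a) u.
Proof. by rewrite /red_ip ipC -/(red_ip _ _) red_ip_pr ipC. Qed.

Lemma red_lcE (a b : red_alg) : lc a b = red_pr (lc (vsval a) (vsval b)).
Proof.
by apply: lc_def => w; rewrite !red_algE /red_br !red_ip_pr lcP.
Qed.

Lemma red_alg_flat : flat g -> flat red_alg.
Proof.
move=> fg a b c; rewrite !red_lcE red_algE /red_br !val_red_pr.
by rewrite lc_projl ?br_perp// !lc_projr ?lc_perp// fg red_prD red_prN.
Qed.

Lemma red_xi_linear : linear (fun a : red_alg => - red_pr (lc (vsval a) zb) : red_alg).
Proof.
by move=> k a b; rewrite red_valP lcDl lcZl red_pr_linear opprD scalerN.
Qed.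
Lemma red_D_linear : linear (fun a : red_alg => red_pr (br zb (vsval a)) : red_alg).
Proof. by move=> k a b; rewrite red_valP brDr brZr red_pr_linear. Qed.
Definition red_xi : 'End(red_alg) := linhom red_xi_linear.
Definition red_D : 'End(red_alg) := linhom red_D_linear.
Definition red_b0 : red_alg := red_pr (lc zb zb).

(** Each condition is the projection to B of an identity of g: of flatness
    for (a, b, zb), (zb, a, zb) and (zb, a, b), and of the Jacobi identity for
    the derivation D. Moreover (D - xi) a is the projection of zb a. *)
Lemma red_admissible : flat g -> admissible red_xi red_D 0 red_b0.
Proof.
move=> fg.
have prE u v : u = v -> red_pr u = red_pr v :> red_alg by move=> ->.
have brE u v : br u v = lc u v - lc v u by rewrite lc_torsion.
have xiE (a : red_alg) : red_xi a = red_pr (- lc (vsval a) zb).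
  by rewrite linhomE red_prN.
have DE (a : red_alg) : red_D a = red_pr (br zb (vsval a)) by rewrite linhomE.
have Nperp u v : ip (- lc u v) z = 0 by rewrite ipNl lc_perp oppr0.
split.
- move=> a b; rewrite !red_algE /red_br !red_lcE !xiE !val_red_pr.
  rewrite lc_projl ?br_perp// !lc_projr ?Nperp// -red_prN -red_prD; apply: prE.
  by rewrite fg !lcE opprD.
- move=> a b; rewrite !red_algE /red_br !DE !val_red_pr.
  rewrite br_projl ?br_perp// !br_projr ?br_perp// -red_prD; apply: prE.
  apply: lie_ip_inj => w; have := congr1 (ip ^~ w) (lie_br_jacobi zb (vsval a) (vsval b)).
  by rewrite /= (brC (vsval b) (br _ _)) (brC (vsval b) zb) linearNr !ipE => h; lra.
split.
- move=> a b; have DxiE (c : red_alg) : (red_D - red_xi) c = red_pr (lc zb (vsval c)).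
    rewrite !(add_lfunE, opp_lfunE) DE xiE -red_prN -red_prD opprK; apply: prE.
    by rewrite -lc_torsion subrK.
  by rewrite !DxiE !red_algE red_ip_pr red_ip_prr lc_skew.
- move=> a; rewrite scale0r subr0 red_lcE !xiE !DE !val_red_pr.
  rewrite br_projr ?Nperp// !lc_projl ?Nperp ?br_perp// lc_projr ?lc_perp//.
  rewrite -!red_prN -!red_prD; apply: prE; apply: lie_ip_inj => w.
  have := congr1 (ip ^~ w) (fg zb (vsval a) zb).
  by rewrite /= !brE !lcE !ipE => h; lra.
- move=> a b; rewrite !red_lcE !xiE !DE !val_red_pr.
  rewrite br_projr ?lc_perp// !lc_projl ?lc_perp ?br_perp// !lc_projr ?Nperp ?br_perp//.
  rewrite -!red_prN -!red_prD; apply: prE; apply: lie_ip_inj => w.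
  have := congr1 (ip ^~ w) (fg zb (vsval a) (vsval b)).
  by rewrite /= !brE !lcE !ipE => h; lra.
Qed.

Definition red_iso_fun (u : g) : dext_space red_alg := (ip u zb, red_pr u, ip u z).

Lemma red_iso_linear : linear red_iso_fun.
Proof.
by move=> k u v; rewrite /red_iso_fun red_pr_linear !ipE.
Qed.

Definition red_iso : 'Hom(g, dext_space red_alg) := linhom red_iso_linear.

Lemma red_decomp u : u = ip u zb *: z + red_proj u + ip u z *: zb.
Proof. by apply: lie_ip_inj => w; rewrite /red_proj !ipE; ring. Qed.

Lemma red_iso_bij : bijective red_iso.
Proof.
exists (fun x => x.1.1 *: z + vsval x.1.2 + x.2 *: zb) => [u|[[s a] t]].
  by rewrite linhomE /= val_red_pr -red_decomp.
have [az azb] := red_val a.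
rewrite linhomE /red_iso_fun /=; congr (_, _, _).
- by rewrite !ipE zzb zbzb azb; ring.
- apply: val_inj; rewrite /= val_red_pr /red_proj !ipE zz zzb (ipC zb) zzb az azb zbzb.
  by apply: lie_ip_inj => w; rewrite !ipE; ring.
- by rewrite !ipE zz (ipC zb) zzb az; ring.
Qed.

Lemma red_iso_ip u v : dext_ip (red_iso u) (red_iso v) = ip u v.
Proof.
rewrite !linhomE /= red_ip_pr val_red_pr /red_proj !ipE.
by rewrite (ipC u v); ring.
Qed.

Lemma red_iso_br u v :
  red_iso (br u v) = dext_br red_xi red_D 0 red_b0 (red_iso u) (red_iso v).
Proof.
rewrite !linhomE /red_iso_fun /= br_perp.
have [A AE] : exists A, A = red_proj u by exists (red_proj u).
have [A' A'E] : exists A', A' = red_proj v by exists (red_proj v).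
have Ap : ip A z = 0 by rewrite AE; have /red_spaceP[] := red_proj_in u.
have A'p : ip A' z = 0 by rewrite A'E; have /red_spaceP[] := red_proj_in v.
have br_gen a b (C : g) a' b' C' :
    br (a *: z + C + b *: zb) (a' *: z + C' + b' *: zb) =
    b *: br zb C' - b' *: br zb C + br C C'.
  rewrite !(brDl, brDr, brZl, brZr) !z_br !(brC _ z) !z_br lie_br_alt (brC C zb).
  by apply: lie_ip_inj => w; rewrite !ipE; ring.
have uv : br u v = ip u z *: br zb A' - ip v z *: br zb A + br A A'.
  by rewrite -(br_gen (ip u zb) _ _ (ip v zb)) AE A'E -!red_decomp.
congr (_, _, _).
- have b0E x : red_ip red_b0 (red_pr x) = ip (lc zb zb) (red_proj x).
    by rewrite red_ip_pr val_red_pr.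
  have xiE x y : lie_ip red_alg (red_xi (red_pr x)) (red_pr y) =
      - ip (lc (red_proj x) zb) (red_proj y).
    by rewrite red_alg_ipE linhomE -red_prN red_ip_pr !val_red_pr ipNl.
  have brzbE C : ip (br zb C) zb = - ip (lc zb zb) C.
    by rewrite -lc_torsion !ipE lc_skew0 subr0 lc_skew ipC.
  have brE : ip (br A A') zb = - ip A' (lc A zb) + ip A (lc A' zb).
    by rewrite -lc_torsion ipDl ipNl !lc_skew; ring.
  rewrite -[red_ip (_ - _) _]red_alg_ipE ipDl ipNl adjointP.
  rewrite (ipC (red_pr u : red_alg)) !xiE !b0E -AE -A'E.
  by rewrite uv !ipE !brzbE brE (ipC A') (ipC A); ring.
- rewrite uv !red_prD red_prN !red_prZ; congr (_ - _ + _).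
  + by rewrite linhomE val_red_pr A'E.
  + by rewrite linhomE val_red_pr AE.
  + by rewrite /red_br !val_red_pr AE A'E.
Qed.

Lemma red_iso_double_extension : is_double_extension red_xi red_D 0 red_b0 g.
Proof.
by exists red_iso; split; [exact: red_iso_bij | exact: red_iso_br | exact: red_iso_ip].
Qed.

(** If D = 0 and b0 = 0 then zb commutes with B, hence is central, although it is
    not orthogonal to z. *)
Lemma red_data_neq0 : (forall w, lie_center g w -> ip z w = 0) ->
  (red_D, red_b0) <> (0, 0).
Proof.
move=> zperp [D0 b00]; suff : lie_center g zb.
  by move=> /zperp; rewrite zzb => /eqP; rewrite oner_eq0.
move=> u; have [C CE] : exists C, C = red_proj u by exists (red_proj u).
rewrite (red_decomp u) -CE !(brDr, brZr) (brC zb z) z_br lie_br_alt.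
rewrite oppr0 !scaler0 add0r addr0.
have Cz : ip C z = 0 by rewrite CE; have /red_spaceP[] := red_proj_in u.
rewrite (red_decomp (br zb C)) br_perp scale0r addr0.
have -> : red_proj (br zb C) = 0.
  have := congr1 (fun f : 'End(red_alg) => vsval (f (red_pr u))) D0.
  by rewrite linhomE !val_red_pr -CE lfunE linear0.
have -> : ip (br zb C) zb = - red_ip red_b0 (red_pr u).
  rewrite red_ip_pr val_red_pr -CE -lc_torsion !ipE lc_skew0 subr0.
  by rewrite lc_skew ipC.
by rewrite b00 /red_ip linear0 ip0l oppr0 scale0r addr0.
Qed.
End Reduction.

Section FlatLorentzian.
Variables (R : realType) (g : prLieAlgebra R).
Local Notation ip := (lie_ip g).

(** Any w with <z, w> = 1 becomes isotropic after subtracting <w, w> / 2 times z. *)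
Lemma isotropic_partner (z : g) : z != 0 -> ip z z = 0 ->
  exists2 zb, ip zb zb = 0 & ip z zb = 1.
Proof.
move=> z0 zz.
have [v vN0] : exists v, ip z v != 0.
  apply: contrapT => H; move/eqP: z0; apply; apply: lie_ip_inj => w.
  by rewrite ip0l; apply/eqP/negPn/negP => ?; apply: H; exists w.
have [w zw] : exists w, ip z w = 1 by exists ((ip z v)^-1 *: v); rewrite ipZr mulVf.
exists (w - (ip w w / 2) *: z); last by rewrite !ipE zz zw; ring.
by rewrite !ipE zz (ipC w z) zw; field.
Qed.

Lemma flat_is_double_extension :
  lorentzian g -> degenerate_on (lie_center g) -> flat g ->
  exists (B : prLieAlgebra R) (xi D : 'End(B)) (b0 : B),
       [/\ riemannian B, flat B, admissible xi D 0%R b0,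
           (D, b0) <> (0%R, 0%R)
         & is_double_extension xi D 0%R b0 g].
Proof.
move=> /lorentzian_positive_on_perp[e0 e0P] [z [zc z0 zperp]] fg.
have zz := zperp _ zc.
have [zb zbzb zzb] := isotropic_partner z0 zz.
have z_lc := flat_central_isotropic_lc e0P fg zc zz.
have perp_pos u : ip u z = 0 -> ip u zb = 0 -> u != 0 -> 0 < ip u u.
  move=> uz uzb u0; apply: (perp_isotropic_pos e0P z0 zz uz) => k.
  apply: contra u0 => /eqP uk; move: uzb; rewrite uk ipE zzb mulr1 => ->.
  by rewrite scale0r.
exists (red_alg zz zbzb zzb perp_pos zc z_lc), (red_xi zz zbzb zzb perp_pos zc z_lc).
exists (red_D zz zbzb zzb perp_pos zc z_lc), (red_b0 zz zbzb zzb perp_pos zc z_lc).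
split.
- exact: red_alg_riemannian.
- exact: red_alg_flat.
- exact: red_admissible.
- exact: red_data_neq0.
- exact: red_iso_double_extension.
Qed.

Lemma lorentzian_flat_unimodular :
  lorentzian g -> degenerate_on (lie_center g) -> flat g -> unimodular g.
Proof.
move=> /lorentzian_positive_on_perp[e0 e0P] [z [zc z0 zperp]] fg.
have zz := zperp _ zc.
have z_lc := flat_central_isotropic_lc e0P fg zc zz.
apply: (flat_unimodular fg e0P z0 zz) => u.
by have := lc_torsion u z; rewrite z_lc subr0 brC zc oppr0.
Qed.
End FlatLorentzian.

(** * Differential inequalities and antiderivatives *)

Section RealLemmas.
Variable R : realType.
Implicit Types (f g df dg : R -> R) (a b t s : R).

Lemma is_derive_continuous (V : normedModType R) (f : R -> V) t d :
  is_derive t 1 f d -> {for t, continuous f}.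
Proof. by move=> [df _]; apply/differentiable_continuous/derivable1_diffP. Qed.

Lemma is_derive_nondecreasing f df a b : a <= b ->
  (forall s, a <= s <= b -> is_derive s (1 : R) f (df s)) ->
  (forall s, a <= s <= b -> 0 <= df s) -> f a <= f b.
Proof.
move=> ab fd df0.
have cf : {within `[a, b], continuous f}.
  by apply: derivable_within_continuous => x; rewrite in_itv /= => /fd [].
have [|c cab E] := MVT_segment (df := df) ab _ cf.
  by move=> x; rewrite in_itv /= => /andP[/ltW ax /ltW xb]; apply: fd; rewrite ax.
move: cab; rewrite in_itv /= => cab.
by rewrite -subr_ge0 E mulr_ge0 ?df0// subr_ge0.
Qed.

Lemma is_derive_le_norm f df g dg a b : a <= b ->
  (forall s, a <= s <= b -> is_derive s (1 : R) f (df s)) ->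
  (forall s, a <= s <= b -> is_derive s (1 : R) g (dg s)) ->
  (forall s, a <= s <= b -> `|df s| <= dg s) -> `|f b - f a| <= g b - g a.
Proof.
move=> ab fd gd fg.
have h1 : (g - f) a <= (g - f) b.
  apply: (@is_derive_nondecreasing _ (dg - df)) => // s sab.
    by apply: is_deriveB; [exact: gd | exact: fd].
  rewrite /= subr_ge0; exact: le_trans (ler_norm _) (fg _ sab).
have h2 : (g + f) a <= (g + f) b.
  apply: (@is_derive_nondecreasing _ (dg + df)) => // s sab.
    by apply: is_deriveD; [exact: gd | exact: fd].
  have := fg _ sab; rewrite ler_norml => /andP[+ _].
  by rewrite lerNl -subr_ge0 opprK.
move: h1 h2; rewrite /= !fctE => h1 h2; rewrite ler_norml; apply/andP; split; lra.
Qed.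

Lemma is_derive_lip f df C a b :
  (forall s, is_derive s (1 : R) f (df s)) -> (forall s, `|df s| <= C) ->
  `|f b - f a| <= C * `|b - a|.
Proof.
move=> fd dfC.
wlog ab : a b / a <= b.
  move=> H; have [|/ltW ba] := leP a b; first exact: H.
  by rewrite distrC (distrC b); exact: H.
rewrite (ger0_norm (_ : 0 <= b - a)) ?subr_ge0// mulrBr.
apply: (@is_derive_le_norm f df (fun s => C * s) (fun=> C)) => // s _.
by apply: is_derive_eq; rewrite /GRing.scale /= mulr1.
Qed.

Lemma is_derive_increment_eq f g df a b : a <= b ->
  (forall s, a <= s <= b -> is_derive s (1 : R) f (df s)) ->
  (forall s, a <= s <= b -> is_derive s (1 : R) g (df s)) ->
  f b - f a = g b - g a.
Proof.
move=> ab fd gd.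
have : `|(f - g) b - (f - g) a| <= cst 0 b - cst 0 a.
  apply: (@is_derive_le_norm (f - g) (df - df) (cst 0) (cst 0)) => // s sab.
  - by apply: is_deriveB; [exact: fd | exact: gd].
  - by rewrite !fctE subrr normr0.
rewrite /= subrr normr_le0 !fctE => /eqP H.
by apply/eqP; rewrite -subr_eq0 -[X in _ == X]H; apply/eqP; ring.
Qed.

Lemma lip_continuous f C : (forall s t, `|f s - f t| <= C * `|s - t|) -> continuous f.
Proof.
move=> fC t; apply/cvgrPdist_le => e e0.
have C1 : 0 < `|C| + 1 by rewrite ltr_wpDl.
near=> s; rewrite (le_trans (fC _ _))//.
have h : `|t - s| <= e / (`|C| + 1).
  near: s; apply: (cvgrPdist_le (fun x : R => x) _).1; [exact: cvg_id | exact: divr_gt0].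
have : `|C| * `|t - s| <= (`|C| + 1) * (e / (`|C| + 1)).
  by apply: ler_pM => //; rewrite lerDl.
rewrite [X in _ <= X]mulrC divfK ?gt_eqF// => h2; apply: le_trans h2.
by apply: ler_wpM2r => //; exact: ler_norm.
Unshelve. all: by end_near. Qed.

(** The fundamental theorem of calculus gives the derivative to the right of the
    base point of the integral only. *)
Lemma antiderivative_gt f (c : R) : 0 < c -> continuous f ->
  exists F : R -> R, F 0 = 0 /\ forall t, - c < t -> is_derive t (1 : R) F (f t).
Proof.
move=> c0 cf.
pose F (x : R) := (\int[@lebesgue_measure R]_(t in [set` `[- c, x]]) f t)%R.
exists (fun x => F x - F 0); split; first by rewrite subrr.
move=> t ct; have t1 : t < t + 1 by rewrite ltrDl.
have fi : (@lebesgue_measure R).-integrable `[- c, t + 1] (EFin \o f).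
  apply: continuous_compact_integrable; first exact: segment_compact.
  exact: continuous_subspaceT.
have [dF F'] := continuous_FTC1_closed t1 fi ct (cf t).
have H : is_derive t (1 : R) F (f t) by apply: DeriveDef => //; rewrite -derive1E.
by have := is_deriveB H (is_derive_cst (F 0) t (1 : R)); rewrite subr0.
Qed.

(** The antiderivatives vanishing at 0 with base points further and further to the
    left agree where they are defined. *)
Lemma antiderivative f : continuous f ->
  exists F : R -> R, F 0 = 0 /\ forall t, is_derive t (1 : R) F (f t).
Proof.
move=> cf.
have [F FP] : exists F : nat -> R -> R, forall n, F n 0 = 0 /\
    forall t, - n.+1%:R < t -> is_derive t (1 : R) (F n) (f t).
  have H n := cid (@antiderivative_gt f n.+1%:R (ltr0Sn _ _) cf).
  by exists (fun n => projT1 (H n)) => n; exact: projT2 (H n).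
have Feq n m t : - n.+1%:R < t -> - m.+1%:R < t -> F n t = F m t.
  move=> nt mt.
  have side a b : - n.+1%:R < a -> - m.+1%:R < a -> a <= b ->
      F n b - F n a = F m b - F m a.
    move=> na ma ab; apply: (is_derive_increment_eq (df := f)) => // s /andP[as_ _].
      by apply: (FP n).2; exact: lt_le_trans as_.
    by apply: (FP m).2; exact: lt_le_trans as_.
  have [t0|/ltW t0] := leP t 0.
    have := side t 0 nt mt t0; rewrite (FP n).1 (FP m).1; lra.
  have := side 0 t; rewrite (FP n).1 (FP m).1 !subr0; apply => //;
    by rewrite oppr_lt0 ltr0Sn.
pose N (t : R) := Num.truncn `|t|.
have Nt t : - (N t).+1%:R < t.
  rewrite ltrNl; apply: le_lt_trans (ler_norm _) _; rewrite normrN.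
  exact: truncnS_gt.
exists (fun t => F (N t) t); split; first exact: (FP _).1.
move=> t; apply: near_eq_is_derive ((FP (N t)).2 t (Nt t)).
near=> s; apply: Feq => //.
by near: s; exact: lt_nbhsr.
Unshelve. all: by end_near. Qed.
End RealLemmas.

(** * Global solutions of bounded Lipschitz systems *)

Section ExpBound.
Variable R : realType.
Implicit Types (f df : R -> R).

Lemma is_derive_reflect f (d t : R) : is_derive (- t) (1 : R) f d ->
  is_derive t (1 : R) (fun s => f (- s)) (- d).
Proof.
move=> fd.
have := is_derive1_comp (f := f) (g := -%R) (x := t) fd (is_deriveNid t (1 : R)).
by rewrite mulrN1.
Qed.

(** The exponential weight turns one integration into a gain of a factor 2: this is
    what makes Picard iteration contract for all times at once. *)
Lemma expR_deriv_bound f df (K c t : R) : 0 < K -> 0 <= c -> f 0 = 0 ->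
  (forall s, is_derive s (1 : R) f (df s)) ->
  (forall s, `|df s| <= K * (c * expR (2 * K * `|s|))) ->
  `|f t| <= c / 2 * expR (2 * K * `|t|).
Proof.
move=> K0 c0.
wlog t0 : f df t / 0 <= t.
  move=> H f0 fd dfb; have [t0|/ltW t0] := leP 0 t; first exact: (H f df).
  have := H (fun s => f (- s)) (fun s => - df (- s)) (- t).
  rewrite opprK normrN; apply; rewrite ?oppr_ge0 ?oppr0//.
  - by move=> s; apply: is_derive_reflect.
  - by move=> s; rewrite normrN; have := dfb (- s); rewrite normrN.
move=> f0 fd dfb.
pose g (s : R) := c / 2 * expR (2 * K * s).
have gd s : is_derive s (1 : R) g (K * (c * expR (2 * K * s))).
  have h : is_derive s (1 : R) (fun s : R => 2 * K * s) (2 * K).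
    by apply: is_derive_eq; rewrite /GRing.scale /= mulr1.
  have := is_derive1_comp (is_derive_expR (2 * K * s)) h => h2.
  have := is_deriveZ (c / 2) h2; rewrite /GRing.scale /= => h3.
  by apply: is_derive_eq; field.
have := @is_derive_le_norm R f df g _ 0 t t0 (fun s _ => fd s) (fun s _ => gd s).
rewrite f0 subr0 /g (ger0_norm t0) mulr0 expR0 mulr1 => H.
apply: le_trans (H _) _; last by rewrite gerBl divr_ge0.
by move=> s /andP[s0 _]; have := dfb s; rewrite (ger0_norm s0).
Qed.
End ExpBound.

Section HalvingLimit.
Variable R : realType.

Lemma le_of_le_halving (a b c : R) : (forall k, a <= b + c / 2 ^+ k) -> a <= b.
Proof.
move=> H; apply/ler_addgt0Pr => e e0.
have [k /ltW ck] : exists k : nat, `|c| / e < k%:R.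
  by exists (Num.truncn (`|c| / e)).+1; exact: truncnS_gt.
apply: le_trans (H k) _; rewrite lerD2l; apply: le_trans (ler_norm _) _.
rewrite normrM normfV (ger0_norm (_ : 0 <= 2 ^+ k)) ?exprn_ge0//.
rewrite ler_pdivrMr ?exprn_gt0//; rewrite ler_pdivrMr// in ck.
apply: le_trans ck _; rewrite mulrC ler_wpM2l ?(ltW e0)//.
by rewrite -natrX ler_nat ltnW// ltn_expl.
Qed.

(** The intervals of center u_k and radius 2 d / 2^k are nested. *)
Lemma halving_limit (u : nat -> R) (d : R) :
  (forall k, `|u k.+1 - u k| <= d / 2 ^+ k) ->
  exists l, forall k, `|l - u k| <= 2 * d / 2 ^+ k.
Proof.
move=> ud; pose a k := u k - 2 * d / 2 ^+ k; pose b k := u k + 2 * d / 2 ^+ k.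
have half k : 2 * d / 2 ^+ k.+1 = d / 2 ^+ k.
  by rewrite exprS; field; rewrite expf_neq0.
have a_mono : {homo a : m n / (m <= n)%N >-> m <= n}.
  apply: homo_leq => [x|y x z|k]; [exact: lexx|exact: le_trans|].
  by rewrite /a half; have := ud k; rewrite ler_norml => /andP[+ _]; lra.
have b_mono : {homo b : m n / (m <= n)%N >-> n <= m}.
  apply: homo_leq => [x|y x z xy yz|k]; [exact: lexx|exact: le_trans yz xy|].
  by rewrite /b half; have := ud k; rewrite ler_norml => /andP[_]; lra.
have ab k : a k <= b k.
  have : 0 <= d / 2 ^+ k by apply: le_trans (ud k).
  by rewrite /a /b; lra.
have aub k : ubound (range a) (b k).
  move=> _ [m _ <-]; apply: le_trans (a_mono _ _ (leq_maxl m k)) _.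
  by apply: le_trans (ab _) (b_mono _ _ (leq_maxr _ _)).
exists (sup (range a)) => k; rewrite ler_norml; apply/andP; split.
  have : a k <= sup (range a) by apply: ub_le_sup; [exists (b k); exact: aub | exists k].
  by rewrite /a; lra.
have : sup (range a) <= b k by apply: ge_sup; [exists (a k), k | exact: aub].
by rewrite /b; lra.
Qed.
End HalvingLimit.

Section Picard.
Variables (R : realType) (I : Type) (F : (I -> R) -> I -> R) (K M : R).
Hypothesis K0 : 0 < K.
Hypothesis M0 : 0 <= M.
Hypothesis F_bounded : forall x j, `|F x j| <= M.
Hypothesis F_lip : forall (x y : I -> R) (c : R), (forall j, `|x j - y j| <= c) ->
  forall j, `|F x j - F y j| <= K * c.
Variable z0 : I -> R.

(** All Picard iterates of a field bounded by M share this modulus, which makes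
    them continuous and passes to the limit. *)
Definition time_lip (w : R -> I -> R) :=
  forall s t j, `|w s j - w t j| <= M * `|s - t|.

Lemma time_lip_comp w j : time_lip w -> continuous (fun s => F (w s) j).
Proof.
move=> wl; apply: (@lip_continuous _ _ (K * M)) => s t.
by rewrite -mulrA; apply: F_lip => i; exact: wl.
Qed.

Lemma picard_step w : time_lip w -> exists w' : R -> I -> R,
  [/\ forall j, w' 0 j = z0 j,
      forall t j, is_derive t (1 : R) (fun s => w' s j) (F (w t) j)
    & time_lip w'].
Proof.
move=> wl.
have [P PP] : exists P : I -> R -> R, forall j, P j 0 = 0 /\
    forall t, is_derive t (1 : R) (P j) (F (w t) j).
  have H j := cid (antiderivative (@time_lip_comp w j wl)).
  by exists (fun j => projT1 (H j)) => j; exact: projT2 (H j).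
have wd t j : is_derive t (1 : R) (fun s => z0 j + P j s) (F (w t) j).
  have := is_deriveD (is_derive_cst (z0 j) t (1 : R)) ((PP j).2 t).
  by rewrite add0r.
exists (fun t j => z0 j + P j t); split=> //.
  by move=> j; rewrite (PP j).1 addr0.
move=> s t j; 
apply: (@is_derive_lip R (fun s => z0 j + P j s) (fun s => F (w s) j) M t s).
by move=> x; exact: F_bounded.
Qed.

(** Two successive iterates differ at time t by at most
    c / 2^k * exp (2 K |t|). *)
Lemma picard_lindelof : exists z : R -> I -> R,
  (forall j, z 0 j = z0 j) /\
  forall t j, is_derive t (1 : R) (fun s => z s j) (F (z t) j).
Proof.
have [step stepP] : exists step : {w | time_lip w} -> {w | time_lip w}, forall w,
    (forall j, sval (step w) 0 j = z0 j) /\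
    (forall t j, is_derive t (1 : R) (fun s => sval (step w) s j) (F (sval w t) j)).
  have H (w : {w | time_lip w}) := cid (picard_step (svalP w)).
  have H3 w : time_lip (projT1 (H w)) by case: (projT2 (H w)).
  exists (fun w => exist _ (projT1 (H w)) (H3 w)) => w /=.
  by case: (projT2 (H w)).
have cst_lip : time_lip (fun=> z0).
  by move=> s t j; rewrite subrr normr0 mulr_ge0.
pose it k := iter k step (exist _ _ cst_lip).
pose c := M / (2 * K).
have c0 : 0 <= c by rewrite divr_ge0// mulr_ge0// ltW.
have step_close (w1 w2 : {w | time_lip w}) d : 0 <= d ->
    (forall t j, `|sval w1 t j - sval w2 t j| <= d * expR (2 * K * `|t|)) ->
    forall t j, `|sval (step w1) t j - sval (step w2) t j|
                <= d / 2 * expR (2 * K * `|t|).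
  move=> d0 w12 t j.
  apply: (@expR_deriv_bound _ (fun s => sval (step w1) s j - sval (step w2) s j)
    (fun s => F (sval w1 s) j - F (sval w2 s) j)) => //.
  - by rewrite !(stepP _).1 subrr.
  - by move=> s; apply: is_deriveB; exact: (stepP _).2.
  - by move=> s; apply: F_lip => i; exact: w12.
have it_close k t j : `|sval (it k.+1) t j - sval (it k) t j| <=
    c / 2 ^+ k * expR (2 * K * `|t|).
  elim: k t j => [|k ih] t j.
    have -> : sval (it 0%N) t j = sval (it 1%N) 0 j by rewrite (stepP _).1.
    rewrite expr0 divr1; apply: le_trans (svalP (it 1%N) _ _ _) _.
    rewrite subr0 /c; have h := expR_ge1Dx (2 * K * `|t|).
    have -> : M * `|t| = M / (2 * K) * (2 * K * `|t|) by field; rewrite gt_eqF.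
    by apply: ler_wpM2l => //; lra.
  have -> : c / 2 ^+ k.+1 = c / 2 ^+ k / 2 by rewrite exprS; field; rewrite expf_neq0.
  by apply: step_close => //; rewrite divr_ge0// exprn_ge0.
have [z zP] : exists z : R -> I -> R, forall t j k,
    `|z t j - sval (it k) t j| <= 2 * c / 2 ^+ k * expR (2 * K * `|t|).
  have H t j : exists l, forall k,
      `|l - sval (it k) t j| <= 2 * (c * expR (2 * K * `|t|)) / 2 ^+ k.
    apply: halving_limit => k; apply: le_trans (it_close _ _ _) _.
    by rewrite mulrAC.
  exists (fun t j => projT1 (cid (H t j))) => t j k.
  apply: le_trans (projT2 (cid (H t j)) k) _.
  by rewrite mulrA mulrAC.
have z_lip : time_lip z.
  move=> s t j; pose e (t : R) := expR (2 * K * `|t|).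
  apply: (@le_of_le_halving _ _ _ (2 * c * (e s + e t))) => k.
  have := zP s j k; have := zP t j k; have := svalP (it k) s t j.
  rewrite -/(e s) -/(e t) !ler_norml => /andP[? ?] /andP[? ?] /andP[? ?].
  have -> : 2 * c * (e s + e t) / 2 ^+ k = 2 * c / 2 ^+ k * e s + 2 * c / 2 ^+ k * e t.
    by ring.
  by apply/andP; split; lra.
pose zl : {w | time_lip w} := exist _ z z_lip.
have stepz : sval (step zl) = z.
  apply/funext => t; apply/funext => j; apply/eqP; rewrite -subr_eq0 -normr_le0.
  pose e := expR (2 * K * `|t|).
  apply: (@le_of_le_halving _ _ _ (2 * c * e)) => k; rewrite add0r.
  have d0 : 0 <= 2 * c / 2 ^+ k by rewrite divr_ge0 ?exprn_ge0// mulr_ge0.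
  have := step_close zl (it k) _ d0 (fun t j => zP t j k) t j.
  have itS : it k.+1 = step (it k) by [].
  have := zP t j k.+1; rewrite itS -/e !ler_norml => /andP[? ?] /andP[? ?].
  have e1 : 2 * c / 2 ^+ k.+1 * e = 2 * c * e / 2 ^+ k / 2.
    by rewrite exprS; field; rewrite expf_neq0.
  have e2 : 2 * c / 2 ^+ k / 2 * e = 2 * c * e / 2 ^+ k / 2 by ring.
  by apply/andP; split; lra.
exists z; split=> [j|t j]; first by rewrite -stepz (stepP zl).1.
by have := (stepP zl).2 t j; rewrite stepz.
Qed.
End Picard.

(** * Differential calculus along curves *)

Section Calculus.
Variable R : realType.

Lemma derive_pair_r (U V W : normedModType R) (f : U * V -> W) y e u :
  'D_u (fun y' => f (y, y')) e = 'D_((0 : U), u) f (y, e).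
Proof.
rewrite /derive; apply: (congr1 (fun g : R -> W => lim (g @ 0^'))).
apply/funext => h /=; congr (_ *: (f _ - _)).
by rewrite -[RHS]/(h *: 0 + y, h *: u + e) scaler0 add0r.
Qed.

Lemma derive_pair_l (U V W : normedModType R) (f : U * V -> W) y e u :
  'D_u (fun y' => f (y', e)) y = 'D_(u, (0 : V)) f (y, e).
Proof.
rewrite /derive; apply: (congr1 (fun g : R -> W => lim (g @ 0^'))).
apply/funext => h /=; congr (_ *: (f _ - _)).
by rewrite -[RHS]/(h *: u + y, h *: 0 + e) scaler0 add0r.
Qed.

Lemma differentiable_pair_r (U V W : normedModType R) (f : U * V -> W) y e :
  differentiable f (y, e) -> differentiable (fun y' => f (y, y')) e.
Proof.
move=> df; have dp : differentiable (fun y' : V => (y, y')) e.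
  by apply: (@differentiable_pair _ _ _ _ (cst y) id).
exact: (differentiable_comp dp df).
Qed.

Lemma differentiable_pair_l (U V W : normedModType R) (f : U * V -> W) y e :
  differentiable f (y, e) -> differentiable (fun y' => f (y', e)) y.
Proof.
move=> df; have dp : differentiable (fun y' : U => (y', e)) y.
  by apply: (@differentiable_pair _ _ _ _ id (cst e)).
exact: (differentiable_comp dp df).
Qed.

Lemma is_derive_rV n (f : R -> 'rV[R]_n) t (d : 'rV[R]_n) :
  (forall j, is_derive t (1 : R) (fun s => f s 0 j) (d 0 j)) ->
  is_derive t (1 : R) f d.
Proof.
move=> fd.
have df : derivable f t 1.
  by apply/derivable_mxP => i j; rewrite ord1; case: (fd j).
apply: DeriveDef => //; rewrite derive_mx//; apply/rowP => j.
by rewrite mxE; case: (fd j).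
Qed.

Lemma is_derive_comp_diff (V W : normedModType R) (f : V -> W) (y : R -> V) t v :
  is_derive t (1 : R) y v -> differentiable f (y t) ->
  is_derive t (1 : R) (f \o y) ('D_v f (y t)).
Proof.
move=> [dy yv] df.
have dy' : differentiable y t by apply/derivable1_diffP.
have dfy : differentiable (f \o y) t by exact: differentiable_comp.
apply: DeriveDef; first exact/derivable1_diffP.
by rewrite deriveE// diff_comp//= -(deriveE _ dy') yv -deriveE.
Qed.

Lemma is_derive_comp_real (V : normedModType R) (f : R -> V) (p : R -> R) t a d :
  is_derive t (1 : R) p a -> is_derive (p t) (1 : R) f d ->
  is_derive t (1 : R) (f \o p) (a *: d).
Proof.
move=> dp [df fd].
have df' : differentiable f (p t) by apply/derivable1_diffP.
have := is_derive_comp_diff dp df'.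
by rewrite deriveE// -[a in 'd _ _ a]mulr1 [a * 1]/(a *: 1) linearZ /= -deriveE// fd.
Qed.

Lemma nbhs_rV n (e : 'rV[R]_n) (P : set 'rV[R]_n) : nbhs e P ->
  exists2 r : R, 0 < r & forall y : 'rV[R]_n, (forall j, `|y 0 j - e 0 j| <= r) -> P y.
Proof.
move=> /nbhs_ballP[r /= r0 rP]; exists (r / 2); first by rewrite divr_gt0.
move=> y yr; apply: rP; split=> // i j; rewrite ord1 /ball /= distrC.
by apply: le_lt_trans (yr j) _; rewrite ltr_pdivrMr// ltr_pMr// ltr1n.
Qed.

(** The mean value inequality along the segment between the two points, which stays
    in the box. *)
Lemma lipschitz_box n (e : 'rV[R]_n) (f : 'rV[R]_n -> R) (r C : R) :
  (forall y : 'rV[R]_n, (forall j, `|y 0 j - e 0 j| <= r) -> differentiable f y) ->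
  (forall y : 'rV[R]_n, (forall j, `|y 0 j - e 0 j| <= r) ->
     forall k, `|'D_('e_k : 'rV[R]_n) f y| <= C) ->
  forall (x y : 'rV[R]_n) (c : R), (forall j, `|x 0 j - e 0 j| <= r) ->
    (forall j, `|y 0 j - e 0 j| <= r) -> (forall j, `|x 0 j - y 0 j| <= c) ->
  `|f x - f y| <= n%:R * C * c.
Proof.
move=> df dfC x y c xr yr xyc.
pose p (s : R) : 'rV[R]_n := y + s *: (x - y).
have pd s : is_derive s (1 : R) p (x - y).
  apply: is_derive_rV => j.
  have -> : (fun s => p s 0 j) = (fun s : R => y 0 j + (x - y) 0 j * s).
    by apply/funext => ?; rewrite !mxE mulrC.
  by apply: is_derive_eq; rewrite /GRing.scale /= add0r mul1r mulr1.
have pr s : 0 <= s <= 1 -> forall j, `|p s 0 j - e 0 j| <= r.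
  move=> /andP[s0 s1] j; rewrite !mxE.
  have -> : y 0 j + s * (x 0 j - y 0 j) - e 0 j =
      (1 - s) * (y 0 j - e 0 j) + s * (x 0 j - e 0 j) by ring.
  apply: le_trans (ler_normD _ _) _; rewrite !normrM (ger0_norm s0).
  rewrite (ger0_norm (_ : 0 <= 1 - s)) ?subr_ge0//.
  have -> : r = (1 - s) * r + s * r by ring.
  by rewrite lerD// ler_wpM2l// subr_ge0.
have Df s : 0 <= s <= 1 -> `|'D_(x - y) f (p s)| <= n%:R * C * c.
  move=> s01; have dfp := df _ (pr _ s01).
  rewrite deriveE// [x - y]row_sum_delta linear_sum /=.
  apply: le_trans (ler_norm_sum _ _ _) _.
  rewrite -mulrA -[X in X%:R]card_ord mulr_natl -sumr_const.
  apply: ler_sum => k _; rewrite linearZ /= -deriveE// normrM mulrC.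
  by apply: ler_pM => //; [exact: dfC (pr _ s01) _ | rewrite !mxE].
have := @is_derive_le_norm R (f \o p) (fun s => 'D_(x - y) f (p s))
  (fun s => n%:R * C * c * s) (fun=> n%:R * C * c) 0 1 ler01.
have -> : (f \o p) 1 = f x by rewrite /= /p scale1r addrC subrK.
have -> : (f \o p) 0 = f y by rewrite /= /p scale0r addr0.
rewrite mulr1 mulr0 subr0; apply => //.
- move=> s s01; apply: (is_derive_comp_diff (pd s)); exact: df (pr _ s01).
- by move=> s _; apply: is_derive_eq; rewrite /GRing.scale /= mulr1.
Qed.
End Calculus.

(** * Local flows of a bilinear-in-velocity system *)

Section BoundedLipschitz.
Variables (R : realType) (I : Type).
Implicit Types (f g : (I -> R) -> R).

(** Bounded and Lipschitz for the sup distance on coordinates: unlike Lipschitz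
    alone, this is stable under products. *)
Definition bdlip f := exists2 C : R, 0 <= C & (forall z, `|f z| <= C) /\
  forall z z' (c : R), 0 <= c -> (forall i, `|z i - z' i| <= c) ->
    `|f z - f z'| <= C * c.

Lemma bdlip_cst a : bdlip (fun=> a).
Proof.
exists `|a| => //; split=> // z z' c c0 _.
by rewrite subrr normr0 mulr_ge0.
Qed.

Lemma bdlipD f g : bdlip f -> bdlip g -> bdlip (fun z => f z + g z).
Proof.
move=> [C C0 [fb fl]] [D D0 [gb gl]]; exists (C + D); first exact: addr_ge0.
split=> [z|z z' c c0 zz']; first by apply: le_trans (ler_normD _ _) _; rewrite lerD.
rewrite opprD addrACA mulrDl; apply: le_trans (ler_normD _ _) _.
by rewrite lerD ?fl ?gl.
Qed.

Lemma bdlipM f g : bdlip f -> bdlip g -> bdlip (fun z => f z * g z).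
Proof.
move=> [C C0 [fb fl]] [D D0 [gb gl]]; exists (C * D + 2 * C * D).
  by rewrite addr_ge0// ?mulr_ge0.
split=> [z|z z' c c0 zz'].
  rewrite normrM; apply: (@le_trans _ _ (C * D)); first exact: ler_pM.
  by rewrite lerDl !mulr_ge0.
have -> : f z * g z - f z' * g z' = f z * (g z - g z') + (f z - f z') * g z'.
  by ring.
apply: le_trans (ler_normD _ _) _; rewrite !normrM.
apply: (@le_trans _ _ (C * (D * c) + C * c * D)).
  by rewrite lerD// ler_pM// ?gl ?fl.
have : 0 <= C * D by apply: mulr_ge0. 
move=> CD; have : 0 <= C * D * c by apply: mulr_ge0.
by move=> ?; lra.
Qed.

Lemma bdlip_sum (J : Type) (r : seq J) (f : J -> (I -> R) -> R) :
  (forall j, bdlip (f j)) -> bdlip (fun z => \sum_(j <- r) f j z).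
Proof.
move=> fb; elim: r => [|j r ih].
  have -> : (fun z => \sum_(j <- [::]) f j z) = (fun=> 0).
    by apply/funext => z; rewrite big_nil.
  exact: bdlip_cst.
have -> : (fun z => \sum_(j <- j :: r) f j z) =
    (fun z => f j z + \sum_(j <- r) f j z).
  by apply/funext => z; rewrite big_cons.
exact: bdlipD.
Qed.

Definition clamp (a r x : R) : R := Num.max (a - r) (Num.min (a + r) x).

Lemma clamp_in a r x : 0 <= r -> `|clamp a r x - a| <= r.
Proof.
move=> r0; rewrite ler_norml /clamp; case: (leP (a + r) x) => h;
  case: (leP (a - r) _) => h'; apply/andP; split; lra.
Qed.

Lemma clamp_id a r x : `|x - a| <= r -> clamp a r x = x.
Proof.
rewrite ler_norml /clamp => /andP[h1 h2]; case: (leP (a + r) x) => h;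
  case: (leP (a - r) _) => h'; lra.
Qed.

Lemma clamp_lip a r x y c : 0 <= r -> `|x - y| <= c ->
  `|clamp a r x - clamp a r y| <= c.
Proof.
move=> r0; rewrite !ler_norml /clamp => /andP[h1 h2].
by case: (leP (a + r) x) => hx; case: (leP (a + r) y) => hy;
  do ?[case: (leP (a - r) _) => ?]; apply/andP; split; lra.
Qed.

Lemma bdlip_clamp a r i : 0 <= r -> bdlip (fun z => clamp a r (z i)).
Proof.
move=> r0; have a0 := normr_ge0 a; exists (`|a| + r + 1); first by lra.
split=> [z|z z' c c0 zz'].
  have h := clamp_in a (z i) r0.
  rewrite -[clamp _ _ _](subrK a) addrC; apply: le_trans (ler_normD _ _) _.
  lra.
apply: (@le_trans _ _ c); first exact: clamp_lip.
have : 0 <= (`|a| + r) * c by rewrite mulr_ge0//; lra.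
by move=> ?; lra.
Qed.
End BoundedLipschitz.

Section LocalFlow.
Variables (R : realType) (n : nat) (e : 'rV[R]_n).
Variables (A : 'I_n -> 'rV[R]_n -> 'I_n -> R) (Q : 'I_n -> 'I_n -> 'I_n -> R).
Variables (r L : R).
Hypotheses (r0 : 0 < r) (L0 : 0 <= L).
Definition in_box (y : 'rV[R]_n) := forall j, `|y 0 j - e 0 j| <= r.
Hypothesis A_lip : forall k j x y (c : R), in_box x -> in_box y ->
  (forall i, `|x 0 i - y 0 i| <= c) -> `|A k x j - A k y j| <= L * c.

(** Clamping y to the box and v to the cube of radius |M| + 1 makes the system
    bounded and Lipschitz everywhere. By its bound K, the solution needs at least
    the time min (r, 1) / K before a clamp becomes active. *)
Lemma local_flow (M : R) : exists2 delta : R, 0 < delta &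
  forall v0 : 'rV[R]_n, (forall j, `|v0 0 j| <= M) ->
  exists y v : R -> 'rV[R]_n, [/\ y 0 = e, v 0 = v0 &
    forall t, `|t| <= delta ->
    [/\ in_box (y t),
        forall j, is_derive t (1 : R) (fun s => y s 0 j)
          (\sum_k v t 0 k * A k (y t) j)
      & forall j, is_derive t (1 : R) (fun s => v s 0 j)
          (\sum_k \sum_l Q k l j * (v t 0 k * v t 0 l))]].
Proof.
pose I := ('I_n + 'I_n)%type.
have M1 : 0 <= `|M| + 1 by rewrite addr_ge0.
pose Y (z : I -> R) : 'rV[R]_n := \row_j clamp (e 0 j) r (z (inl j)).
pose V (z : I -> R) j := clamp 0 (`|M| + 1) (z (inr j)).
have Ybox z : in_box (Y z) by move=> j; rewrite mxE; apply: clamp_in; exact: ltW.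
have Vb k : bdlip (fun z => V z k) by apply: bdlip_clamp.
have Ab k j : bdlip (fun z => A k (Y z) j).
  have Lr0 : 0 <= L * r by rewrite mulr_ge0// ltW.
  exists (`|A k e j| + L * r + L); first by rewrite !addr_ge0.
  split=> [z|z z' c c0 zz'].
    have ebox : in_box e by move=> i; rewrite subrr normr0 ltW.
    have := A_lip k j (Ybox z) ebox (Ybox z).
    rewrite -[A k (Y z) j](subrK (A k e j)) => h.
    apply: le_trans (ler_normD _ _) _; rewrite addrK in h.
    by rewrite addrC -addrA lerD2l; apply: le_trans h _; rewrite lerDl.
  apply: (@le_trans _ _ (L * c)).
    apply: A_lip => // i; rewrite !mxE; apply: clamp_lip => //; exact: ltW.
  by apply: ler_wpM2r => //; rewrite lerDr addr_ge0// mulr_ge0// ltW.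
pose F (z : I -> R) (i : I) : R := match i with
  | inl j => \sum_k V z k * A k (Y z) j
  | inr j => \sum_k \sum_l Q k l j * (V z k * V z l) end.
have Fb i : bdlip (fun z => F z i).
  case: i => j /=; apply: bdlip_sum => k; first exact: bdlipM.
  apply: bdlip_sum => l; apply: bdlipM; [exact: bdlip_cst | exact: bdlipM].
have [K [K0 Kb Kl]] : exists K : R, [/\ 0 < K, forall z i, `|F z i| <= K &
   forall (z z' : I -> R) (c : R), (forall i, `|z i - z' i| <= c) ->
    forall i, `|F z i - F z' i| <= K * c].
  have [C CP] : exists C : I -> R, forall i, 0 <= C i /\ ((forall z, `|F z i| <= C i) /\
     forall z z' (c : R), 0 <= c -> (forall i, `|z i - z' i| <= c) ->
    `|F z i - F z' i| <= C i * c).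
    have H i : {C : R | 0 <= C /\ ((forall z, `|F z i| <= C) /\
      forall z z' (c : R), 0 <= c -> (forall i, `|z i - z' i| <= c) ->
      `|F z i - F z' i| <= C * c)}.
      by apply: cid; have [C C0 CP] := Fb i; exists C.
    by exists (fun i => projT1 (H i)) => i; exact: (projT2 (H i)).
  exists (1 + \sum_i C i).
  have Ci i : C i <= 1 + \sum_i C i.
    rewrite (bigD1 i)//= addrCA lerDl addr_ge0//.
    by apply: sumr_ge0 => k _; exact: (CP k).1.
  split.
  - by rewrite ltr_wpDr// sumr_ge0// => k _; exact: (CP k).1.
  - by move=> z i; apply: le_trans ((CP i).2.1 z) (Ci i).
  - move=> z z' c zz' i; have c0 : 0 <= c by apply: le_trans (zz' i).
    apply: le_trans ((CP i).2.2 z z' c c0 zz') _; exact: ler_wpM2r.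
(* 1 is the margin between M and the radius of the clamp on velocities *)
pose rho := Num.min r 1.
have rho0 : 0 < rho by rewrite lt_min r0 ltr01.
exists (rho / K); first exact: divr_gt0.
move=> v0 v0M.
pose z0 (i : I) : R := match i with inl j => e 0 j | inr j => v0 0 j end.
have [z [z00 zd]] := picard_lindelof K0 (ltW K0) Kb Kl z0.
exists (fun t => \row_j z t (inl j)), (fun t => \row_j z t (inr j)); split.
- by apply/rowP => j; rewrite mxE z00.
- by apply/rowP => j; rewrite mxE z00.
move=> t tK.
have close i : `|z t i - z0 i| <= rho.
  rewrite -z00; apply: le_trans (is_derive_lip (C := K) _ _ (fun s => zd s i) _) _.
    by move=> s; exact: Kb.
  by rewrite subr0 mulrC -ler_pdivlMr.
have Yt : Y (z t) = \row_j z t (inl j).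
  apply/rowP => j; rewrite !mxE clamp_id//.
  by apply: le_trans (close (inl j)) _; rewrite ge_min lexx.
have Vt k : V (z t) k = z t (inr k).
  apply: clamp_id; rewrite subr0 -[z t _](subrK (v0 0 k)) addrC.
  apply: le_trans (ler_normD _ _) _; apply: lerD.
    by apply: le_trans (v0M k) (ler_norm _).
  by apply: le_trans (close (inr k)) _; rewrite ge_min lexx orbT.
split.
- by rewrite -Yt.
- move=> j.
  have -> : (fun s => (\row_j z s (inl j)) 0 j) = (fun s => z s (inl j)).
    by apply/funext => s; rewrite mxE.
  have -> : \sum_k (\row_j z t (inr j)) 0 k * A k (\row_j z t (inl j)) j =
      F (z t) (inl j).
    by apply: eq_bigr => k _; rewrite mxE Vt Yt.
  exact: zd.
- move=> j.
  have -> : (fun s => (\row_j z s (inr j)) 0 j) = (fun s => z s (inr j)).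
    by apply/funext => s; rewrite mxE.
  have -> : \sum_k \sum_l Q k l j *
      ((\row_j z t (inr j)) 0 k * (\row_j z t (inr j)) 0 l) = F (z t) (inr j).
    by apply: eq_bigr => k _; apply: eq_bigr => l _; rewrite !mxE !Vt.
  exact: zd.
Qed.
End LocalFlow.

(** * Left-invariant fields in a chart *)

Section Chart.
Variables (R : realType) (n : nat) (G : lieGroup R n) (c : chart R n G).
Hypotheses (c_atlas : atlas c) (c_one : chart_dom c 1%g).
Local Notation inv := (chart_inv c).
Local Notation img := (chart_img c).
Local Notation e := (c 1%g).

Lemma chart_img_dom y : img y -> chart_dom c (inv y).
Proof. by move=> [x xd <-]; rewrite chart_mapK. Qed.

Lemma chart_invK y : img y -> c (inv y) = y.
Proof. by move=> [x xd <-]; rewrite chart_mapK. Qed.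

Lemma chart_img_one : img e. Proof. by exists 1%g. Qed.
Lemma chart_img_near_one : \forall y \near e, img y.
Proof.
by apply: open_nbhs_nbhs; split; [exact: chart_img_open | exact: chart_img_one].
Qed.
Lemma chart_inv_one : inv e = 1%g. Proof. by rewrite chart_mapK. Qed.

Definition chart_mul (p : 'rV[R]_n * 'rV[R]_n) : 'rV[R]_n :=
  c (inv p.1 * inv p.2)%g.

Definition chart_mul_dom : set ('rV[R]_n * 'rV[R]_n) :=
  [set p | [/\ img p.1, img p.2 & chart_dom c (inv p.1 * inv p.2)%g]].

Lemma chart_mul_smooth : smooth chart_mul_dom chart_mul.
Proof. exact: lie_mul_smooth. Qed.

Lemma chart_mul_dom_one y : img y -> chart_mul_dom (y, e).
Proof.
move=> yi; split=> //=; first exact: chart_img_one.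
by rewrite chart_inv_one mulg1; exact: chart_img_dom.
Qed.

Lemma left_fieldE u y : left_field c u y = 'D_((0 : 'rV[R]_n), u) chart_mul (y, e).
Proof. by rewrite /left_field -(derive_pair_r chart_mul). Qed.

Lemma chart_mul_differentiable p : chart_mul_dom p -> differentiable chart_mul p.
Proof. by case: (chart_mul_smooth 1%N) => + _; apply. Qed.

Lemma left_field_sum u y : img y ->
  left_field c u y = \sum_k u 0 k *: left_field c 'e_k y.
Proof.
move=> yi; have d := chart_mul_differentiable (chart_mul_dom_one yi).
have ld := differentiable_pair_r d.
rewrite {1}/left_field deriveE// [u in LHS]row_sum_delta linear_sum.
by apply: eq_bigr => k _; rewrite linearZ /= -deriveE.
Qed.

Lemma left_field_coord_differentiable k j y : img y ->
  differentiable (fun y => left_field c 'e_k y 0 j) y.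
Proof.
move=> yi.
have [_ /(_ (0, 'e_k))[d _]] := chart_mul_smooth 2%N.
have d1 := differentiable_pair_l (d _ (chart_mul_dom_one yi)).
have -> : (fun y => left_field c 'e_k y 0 j) =
    (fun M : 'rV[R]_n => M 0 j) \o
    (fun y => 'D_((0 : 'rV[R]_n), 'e_k) chart_mul (y, e)).
  by apply/funext => x; rewrite left_fieldE.
apply: differentiable_comp => //; exact: differentiable_coord.
Qed.

Lemma left_field_coord_derive k j l y : img y ->
  'D_('e_l : 'rV[R]_n) (fun y => left_field c 'e_k y 0 j) y =
  'D_('e_l, (0 : 'rV[R]_n)) ('D_((0 : 'rV[R]_n), 'e_k) chart_mul) (y, e) 0 j.
Proof.
move=> yi.
have [_ /(_ (0, 'e_k))[d _]] := chart_mul_smooth 2%N.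
have d1 := differentiable_pair_l (d _ (chart_mul_dom_one yi)).
have -> : (fun y => left_field c 'e_k y 0 j) =
    (fun y => 'D_((0 : 'rV[R]_n), 'e_k) chart_mul (y, e) 0 j).
  by apply/funext => x; rewrite left_fieldE.
rewrite -derive_pair_l derive_mx ?mxE//; exact: diff_derivable.
Qed.

Lemma left_field_derive_bounded k j l : exists C : R, \forall y \near e,
  `|'D_('e_l : 'rV[R]_n) (fun y => left_field c 'e_k y 0 j) y| <= C.
Proof.
have [_ /(_ (0, 'e_k))[_ /(_ ('e_l, 0)) ct]] := chart_mul_smooth 2%N.
pose f (y : 'rV[R]_n) : R :=
  'D_('e_l, (0 : 'rV[R]_n)) ('D_((0 : 'rV[R]_n), 'e_k) chart_mul) (y, e) 0 j.
have fc : {for e, continuous f}.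
  have h1 : {for e, continuous (fun y : 'rV[R]_n => (y, e))}.
    by apply: differentiable_continuous; apply: (@differentiable_pair _ _ _ _ id (cst e)).
  have h2 := continuous_comp h1 (ct _ (chart_mul_dom_one chart_img_one)).
  exact: (continuous_comp h2 (@coord_continuous _ _ _ 0 j _)).
exists (`|f e| + 1); near=> y.
have yi : img y by near: y; exact: chart_img_near_one.
rewrite left_field_coord_derive// -/(f y).
have : `|f e - f y| <= 1 by near: y; move/cvgrPdist_le : fc; apply; exact: ltr01.
move=> h; rewrite -[f y](subrK (f e)) addrC; apply: le_trans (ler_normD _ _) _.
by rewrite lerD2l distrC.
Unshelve. all: by end_near. Qed.

Lemma chart_good_nbhs : \forall y \near e, img y /\ chart_dom c ((inv y)^-1)%g.
Proof.
near=> y; split.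
  by near: y; exact: chart_img_near_one.
near: y; have h1 : {for e, continuous inv}.
  by apply: chart_inv_continuous; exact: chart_img_one.
have h2 : {for e, continuous (fun y => (inv y)^-1)%g}.
  by apply: (continuous_comp h1); exact: invg_continuous.
apply: h2; rewrite chart_inv_one invg1.
by apply: open_nbhs_nbhs; split; [exact: chart_dom_open | exact: c_one].
Unshelve. all: by end_near. Qed.

(** The coordinates of the left-invariant fields are first derivatives of the smooth
    multiplication, so their partial derivatives are continuous, hence bounded
    near the identity. The box is also small enough for the inverses of its points
    to lie in the domain of the chart, where left velocities are read. *)
Lemma left_field_lipschitz : exists r L : R, [/\ 0 < r, 0 <= L,
  forall y, in_box e r y -> img y /\ chart_dom c ((inv y)^-1)%g &
  forall k j x y (C : R), in_box e r x -> in_box e r y ->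
  (forall i, `|x 0 i - y 0 i| <= C) ->
  `|left_field c 'e_k x 0 j - left_field c 'e_k y 0 j| <= L * C].
Proof.
have [C CP] : exists C : 'I_n -> 'I_n -> 'I_n -> R, forall k j l, \forall y \near e,
  `|'D_('e_l : 'rV[R]_n) (fun y => left_field c 'e_k y 0 j) y| <= C k j l.
  have H k j l := cid (left_field_derive_bounded k j l).
  by exists (fun k j l => projT1 (H k j l)) => k j l; exact: projT2 (H k j l).
have allC : \forall y \near e, forall p : 'I_n * 'I_n * 'I_n,
    `|'D_('e_p.2 : 'rV[R]_n) (fun y => left_field c 'e_p.1.1 y 0 p.1.2) y|
    <= C p.1.1 p.1.2 p.2.
  exact: (filter_forall _ (fun p : 'I_n * 'I_n * 'I_n => CP p.1.1 p.1.2 p.2)).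
have [r r0 rP] := nbhs_rV (filterI chart_good_nbhs allC).
pose D := \sum_k \sum_j \sum_l `|C k j l|.
have D0 : 0 <= D by do 3![apply: sumr_ge0 => ? _].
have CD k j l : C k j l <= D.
  have le1 (F : 'I_n -> R) m : (forall i, 0 <= F i) -> F m <= \sum_i F i.
    by move=> F0; rewrite (bigD1 m)//= lerDl sumr_ge0.
  apply: le_trans (ler_norm _) _.
  apply: le_trans (le1 (fun l => `|C k j l|) l _) _ => //.
  apply: le_trans (le1 (fun j => \sum_l `|C k j l|) j _) _.
    by move=> ?; apply: sumr_ge0.
  by apply: (le1 (fun k => \sum_j \sum_l `|C k j l|)) => ?; do 2![apply: sumr_ge0 => ? _].
exists r, (n%:R * D); split=> //.
- exact: mulr_ge0.
- by move=> y /rP[].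
- move=> k j x y c' xr yr xy.
  apply: (@lipschitz_box R n e (fun y => left_field c 'e_k y 0 j) r D) => // z zr.
    by have [[zi _] _] := rP _ zr; exact: left_field_coord_differentiable.
  move=> l; have [_ /(_ (k, j, l)) /= h] := rP _ zr.
  exact: le_trans h (CD _ _ _).
Qed.

End Chart.

(** * Geodesics near the identity *)

Section LocalGeodesic.
Variables (R : realType) (n : nat) (G : lieGroup R n) (c : chart R n G).
Hypotheses (c_atlas : atlas c) (c_one : chart_dom c 1%g).
Variables (g : prLieAlgebra R) (i : 'Hom(g, 'rV[R]_n)).
Hypothesis i_bij : bijective i.
Local Notation inv := (chart_inv c).
Local Notation img := (chart_img c).
Local Notation e := (c 1%g).

(** The pointwise content of [geodesic], so that geodesics can be cut and glued. *)
Definition geodesic_at (gamma : R -> G) (x : R -> g) (t : R) : Prop :=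
  [/\ {for t, continuous gamma},
      is_derive (0 : R) (1 : R)
        (fun h : R => c ((gamma t)^-1 * gamma (t + h)%R)%g) (i (x t))
    & is_derive t (1 : R) (fun s : R => i (x s)) (i (- lc (x t) (x t)))].

Lemma mulg_left_continuous (a : G) : continuous (fun x : G => (a * x)%g).
Proof.
move=> x; have h : {for x, continuous (fun x : G => (a, x))}.
  by apply: cvg_pair; [exact: cvg_cst | exact: cvg_id].
exact: (continuous_comp h (@mulg_continuous G _)).
Qed.

(** The left translations by the point of coordinates y and by its inverse are
    inverse to each other; the former has derivative v |-> left_field c v y at 1. *)
Lemma derive_left_translate y v : img y -> chart_dom c ((inv y)^-1)%g ->
  differentiable (fun w => c ((inv y)^-1 * inv w)%g) y /\
  'D_(left_field c v y) (fun w => c ((inv y)^-1 * inv w)%g) y = v.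
Proof.
move=> yi yd; pose a := c ((inv y)^-1)%g.
have ai : img a by exists ((inv y)^-1)%g.
have inva : inv a = ((inv y)^-1)%g by rewrite chart_mapK.
have adom : chart_mul_dom c (a, y).
  split=> //=; rewrite inva mulVg; exact: c_one.
pose psi w := c ((inv y)^-1 * inv w)%g.
have psiE : psi = (fun w => chart_mul c (a, w)).
  by apply/funext => w; rewrite /chart_mul /= inva.
have dpsi : differentiable psi y.
  rewrite psiE; apply: differentiable_pair_r.
  exact: (chart_mul_differentiable c_atlas).
split=> //.
pose la w := c (inv y * inv w)%g.
have dla : differentiable la e.
  apply: (differentiable_pair_r (f := chart_mul c)).
  apply: (chart_mul_differentiable c_atlas); exact: chart_mul_dom_one.
have lae : la e = y by rewrite /la (chart_inv_one c_one) mulg1 chart_invK.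
have dpsi' : differentiable psi (la e) by rewrite lae.
have -> : 'D_(left_field c v y) psi y = 'D_v (psi \o la) e.
  have dcomp := differentiable_comp dla dpsi'.
  rewrite (deriveE v dcomp) (diff_comp dla dpsi').
  have -> : left_field c v y = 'd la e v by rewrite -(deriveE v dla).
  by rewrite -[y in LHS]lae (deriveE _ dpsi').
rewrite (@near_eq_derive _ _ _ _ id) ?derive_id//.
near=> w; rewrite /= /psi /la.
have wi : img w by near: w; exact: chart_img_near_one.
have wd : chart_dom c (inv y * inv w)%g.
  near: w; have h1 : {for e, continuous inv}.
    by apply: chart_inv_continuous; exact: chart_img_one.
  have h2 : {for e, continuous (fun w => inv y * inv w)%g}.
    exact: (continuous_comp h1 (@mulg_left_continuous (inv y) _)).
  apply: h2; rewrite (chart_inv_one c_one) mulg1.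
  by apply: open_nbhs_nbhs; split; [exact: chart_dom_open | exact: chart_img_dom].
by rewrite chart_mapK// mulKg chart_invK.
Unshelve. all: by end_near. Qed.

(** The point y of the geodesic in the chart and its velocity v solve
    y' = left_field c v y and v' = - v v. *)
Lemma local_geodesic (M : R) : exists2 delta : R, 0 < delta &
  forall u : g, (forall j, `|i u 0 j| <= M) ->
  exists (gamma : R -> G) (x : R -> g), [/\ gamma 0 = 1%g, x 0 = u &
    forall t, `|t| <= delta -> geodesic_at gamma x t].
Proof.
have [h ihK hiK] := i_bij.
have [r [L [r0 L0 rbox Llip]]] := left_field_lipschitz c_atlas c_one.
pose Q (k l j : 'I_n) : R := - i (lc (h 'e_k) (h 'e_l)) 0 j.
have [delta d0 dP] := @local_flow R n e (fun k y j => left_field c 'e_k y 0 j)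
  Q r L r0 L0 Llip M.
have i_sum (v : 'rV[R]_n) : h v = \sum_k v 0 k *: h 'e_k.
  apply: (can_inj ihK); rewrite hiK linear_sum [LHS]row_sum_delta.
  by apply: eq_bigr => k _; rewrite linearZ /= hiK.
have lc_suml (u : 'I_n -> g) w : lc (\sum_k u k) w = \sum_k lc (u k) w.
  by apply: (big_morph (fun x : g => lc x w)) => [a b|]; rewrite ?lcDl ?lc0l.
have lc_sumr (u : 'I_n -> g) w : lc w (\sum_k u k) = \sum_k lc w (u k).
  by apply: (big_morph (fun x : g => lc w x)) => [a b|]; rewrite ?lcDr ?lc0r.
have QE (v : 'rV[R]_n) j :
    \sum_k \sum_l Q k l j * (v 0 k * v 0 l) = i (- lc (h v) (h v)) 0 j.
  rewrite {1 2}(i_sum v) lc_suml linearN linear_sum !mxE summxE -sumrN.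
  apply: eq_bigr => k _; rewrite lc_sumr linear_sum summxE -sumrN.
  apply: eq_bigr => l _; rewrite lcZl lcZr !linearZ /= !mxE /Q; ring.
exists delta => // u uM.
have [y [v [y0 v0 yvP]]] := dP (i u) uM.
exists (fun t => inv (y t)), (fun t => h (v t)); split.
- by rewrite y0 (chart_inv_one c_one).
- by rewrite v0 ihK.
move=> t /yvP[ybox yd vd].
have [yi ydom] := rbox _ ybox.
have yD : is_derive t (1 : R) y (left_field c (v t) (y t)).
  apply: is_derive_rV => j; rewrite (left_field_sum c_atlas c_one _ yi) summxE.
  have -> : \sum_k (v t 0 k *: left_field c 'e_k (y t)) 0 j =
      \sum_k v t 0 k * left_field c 'e_k (y t) 0 j.
    by apply: eq_bigr => k _; rewrite mxE.
  exact: yd.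
have [dpsi psiD] := derive_left_translate (v t) yi ydom.
split.
- apply: (continuous_comp (is_derive_continuous yD)).
  by apply: chart_inv_continuous.
- rewrite /= hiK.
  have y1 : is_derive (0 : R) (1 : R) (fun h : R => y (t + h)) (left_field c (v t) (y t)).
    have sh : is_derive (0 : R) (1 : R) (fun h : R => t + h) 1.
      have := is_deriveD (is_derive_cst t 0 (1 : R)) (is_derive_id (0 : R) (1 : R)).
      by rewrite add0r.
    have yD' : is_derive (t + 0) (1 : R) y (left_field c (v t) (y t)) by rewrite addr0.
    by have := is_derive_comp_real sh yD'; rewrite scale1r.
  have := is_derive_comp_diff y1 (f := fun w => c ((inv (y t))^-1 * inv w)%g).
  by rewrite addr0 psiD; apply.
- have -> : (fun s => i (h (v s))) = v by apply/funext => s; rewrite hiK.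
  by apply: is_derive_rV => j; rewrite -QE; exact: vd.
Qed.
End LocalGeodesic.

(** * Gluing and moving geodesics *)

Section Gluing.
Variables (R : realType).

Lemma is_deriveP (V : normedModType R) (f : R -> V) t d :
  is_derive t (1 : R) f d <->
  (fun h : R => h^-1 *: (f (h + t) - f t)) @ (0 : R)^' --> d.
Proof.
have E : (fun h : R => h^-1 *: ((f \o shift t) (h *: (1 : R)) - f t)) =
         (fun h : R => h^-1 *: (f (h + t) - f t)).
  by apply/funext => h /=; rewrite [h *: 1]mulr1.
split=> [[df <-]|H].
  by rewrite -E; exact: df.
have df : derivable f t 1 by rewrite /derivable E; apply/cvg_ex; exists d.
by apply: DeriveDef => //; rewrite /derive E; exact: cvg_lim.
Qed.

(** Both difference quotients converge to the same limit, and f takes its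
    difference quotients from them. *)
Lemma is_derive_glue (V : normedModType R) (f f1 f2 : R -> V) t d :
  (forall s, f s = f1 s \/ f s = f2 s) -> f1 t = f t -> f2 t = f t ->
  is_derive t (1 : R) f1 d -> is_derive t (1 : R) f2 d ->
  is_derive t (1 : R) f d.
Proof.
move=> fE f1t f2t /is_deriveP d1 /is_deriveP d2; apply/is_deriveP.
apply/cvgrPdist_le => eps eps0.
move/cvgrPdist_le : d1 => /(_ eps eps0) h1.
move/cvgrPdist_le : d2 => /(_ eps eps0) h2.
apply: filterS2 h1 h2 => h q1 q2.
by have [->|->] := fE (h + t); [rewrite -f1t | rewrite -f2t].
Qed.

Lemma continuous_glue (T : topologicalType) (f f1 f2 : R -> T) t :
  (forall s, f s = f1 s \/ f s = f2 s) -> f1 t = f t -> f2 t = f t ->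
  {for t, continuous f1} -> {for t, continuous f2} -> {for t, continuous f}.
Proof.
move=> fE f1t f2t c1 c2 P Pt.
have h1 : \forall s \near t, P (f1 s) by apply: c1; rewrite f1t.
have h2 : \forall s \near t, P (f2 s) by apply: c2; rewrite f2t.
by apply: filterS2 h1 h2 => s ? ?; have [/= ->|/= ->] := fE s.
Qed.
End Gluing.

Section GeodesicAt.
Variables (R : realType) (n : nat) (G : lieGroup R n) (c : chart R n G).
Variables (g : prLieAlgebra R) (i : 'Hom(g, 'rV[R]_n)).
Implicit Types (gamma : R -> G) (x : R -> g) (t : R).
Local Notation geod := (geodesic_at c i).

Lemma geodesic_at_glue gamma gamma1 gamma2 x x1 x2 t :
  (forall s, (gamma s = gamma1 s /\ x s = x1 s) \/
             (gamma s = gamma2 s /\ x s = x2 s)) ->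
  gamma1 t = gamma t -> gamma2 t = gamma t -> x1 t = x t -> x2 t = x t ->
  geod gamma1 x1 t -> geod gamma2 x2 t -> geod gamma x t.
Proof.
move=> E g1 g2 e1 e2 [c1 l1 v1] [c2 l2 v2].
have Eg s : gamma s = gamma1 s \/ gamma s = gamma2 s.
  by have [[? _]|[? _]] := E s; [left|right].
split.
- exact: (continuous_glue Eg).
- apply: (is_derive_glue _ _ _ (f1 := fun h => c ((gamma1 t)^-1 * gamma1 (t + h)%R)%g)
    (f2 := fun h => c ((gamma2 t)^-1 * gamma2 (t + h)%R)%g)).
  + by move=> s; rewrite g1 g2; have [->|->] := Eg (t + s); [left|right].
  + by rewrite addr0 g1.
  + by rewrite addr0 g2.
  + by rewrite -e1.
  + by rewrite -e2.
- apply: (is_derive_glue _ _ _ (f1 := fun s => i (x1 s)) (f2 := fun s => i (x2 s))).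
  + by move=> s; have [[_ ->]|[_ ->]] := E s; [left|right].
  + by rewrite e1.
  + by rewrite e2.
  + by rewrite -e1.
  + by rewrite -e2.
Qed.

Lemma geodesic_at_near gamma gamma' x x' t :
  (\forall s \near t, gamma s = gamma' s /\ x s = x' s) ->
  geod gamma x t -> geod gamma' x' t.
Proof.
move=> E [ct l v]; have [gt xt] := nbhs_singleton E.
have Eg : \forall s \near t, gamma s = gamma' s by apply: filterS E => s [].
have Ex : \forall s \near t, i (x s) = i (x' s) by apply: filterS E => s [_ ->].
split.
- rewrite /prop_for /continuous_at -gt.
  by apply: cvg_trans ct; apply: near_eq_cvg.
- rewrite -xt; apply: near_eq_is_derive l; near=> h.
  rewrite -gt; congr (c (_ * _)%g); near: h.
  have sh : (fun h : R => t + h) @ (0 : R) --> t.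
    by rewrite -[X in _ --> X]addr0; apply: cvgD; [exact: cvg_cst|exact: cvg_id].
  exact: sh Eg.
- by rewrite -xt; apply: near_eq_is_derive v.
Unshelve. all: by end_near. Qed.

Lemma geodesic_at_translate (p : G) (t0 : R) gamma x t : geod gamma x (t - t0) ->
  geod (fun s => p * gamma (s - t0)%R)%g (fun s => x (s - t0)) t.
Proof.
move=> [ct l v].
have sh : is_derive t (1 : R) (fun s : R => s - t0) 1.
  have := is_deriveB (is_derive_id t (1 : R)) (is_derive_cst t0 t (1 : R)).
  by rewrite subr0.
split.
- have h1 := continuous_comp (is_derive_continuous sh) ct.
  exact: (continuous_comp h1 (@mulg_left_continuous R n G p _)).
- have -> : (fun h => c ((p * gamma (t - t0))^-1 * (p * gamma (t + h - t0)%R))%g) =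
     (fun h => c ((gamma (t - t0))^-1 * gamma (t - t0 + h)%R)%g).
    by apply/funext => h; rewrite invgM mulgA mulgVK addrAC.
  exact: l.
- by have := is_derive_comp_real sh v; rewrite scale1r.
Qed.

(** Reversing time preserves the equation x' = - x x, whose right-hand side is
    quadratic. *)
Lemma geodesic_at_reflect gamma x t : geod gamma x (- t) ->
  geod (fun s => gamma (- s)) (fun s => - x (- s)) t.
Proof.
move=> [ct l v].
split.
- exact: (continuous_comp (is_derive_continuous (is_deriveNid t (1 : R))) ct).
- have N0 : is_derive (0 : R) (1 : R) (fun h : R => - h) (- 1) by exact: is_deriveNid.
  rewrite linearN -[X in is_derive _ _ _ X]scaleN1r.
  have l' : is_derive (- 0 : R) (1 : R)
      (fun h : R => c ((gamma (- t))^-1 * gamma (- t + h)%R)%g) (i (x (- t))).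
    by rewrite oppr0.
  have := is_derive_comp_real N0 l'.
  have -> // : (fun h : R => c ((gamma (- t))^-1 * gamma (- t + h)%R)%g) \o -%R =
     (fun h => c ((gamma (- t))^-1 * gamma (- (t + h))%R)%g).
  by apply/funext => h /=; rewrite opprD.
- rewrite /= lcNl lcNr opprK.
  have -> : (fun s => i (- x (- s))) = - ((fun s => i (x s)) \o -%R).
    by apply/funext => s; rewrite linearN.
  have := is_deriveN (is_derive_comp_real (is_deriveNid t (1 : R)) v).
  by rewrite scaleN1r opprK.
Qed.

End GeodesicAt.

(** * Completeness from a bound on velocities *)

Section Completeness.
Variables (R : realType) (n : nat) (G : lieGroup R n) (c : chart R n G).
Hypotheses (c_atlas : atlas c) (c_one : chart_dom c 1%g).
Variables (g : prLieAlgebra R) (i : 'Hom(g, 'rV[R]_n)).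
Hypothesis i_bij : bijective i.
Local Notation geod := (geodesic_at c i).

Definition geodesic_on (T : R) (gx : (R -> G) * (R -> g)) : Prop :=
  forall t, 0 <= t <= T -> geod gx.1 gx.2 t.

Definition agree_until (T : R) (gx hx : (R -> G) * (R -> g)) : Prop :=
  forall t, t <= T -> gx.1 t = hx.1 t /\ gx.2 t = hx.2 t.

(** The bound M may depend on the initial velocity and on the time T, but not on
    the solution nor on its domain of definition [0, T']. *)
Definition velocity_bounded : Prop := forall (u : g) (T : R), exists M : R,
  forall (x : R -> g) (T' : R), x 0 = u -> T' <= T ->
  (forall t, 0 <= t <= T' ->
     is_derive t (1 : R) (fun s => i (x s)) (i (- lc (x t) (x t)))) ->
  forall t, 0 <= t <= T' -> forall j, `|i (x t) 0 j| <= M.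

Hypothesis bounded : velocity_bounded.

(** The local geodesic with initial velocity x T, translated by gamma T and shifted
    by the time T, prolongs the given one. The time gained depends on M only. *)
Lemma geodesic_extend (M : R) : exists2 delta : R, 0 < delta &
  forall T gx, 0 <= T -> geodesic_on T gx -> (forall j, `|i (gx.2 T) 0 j| <= M) ->
  exists2 hx, geodesic_on (T + delta) hx & agree_until T gx hx.
Proof.
have [delta d0 dP] := local_geodesic c_atlas c_one i_bij M.
exists delta => // T [gamma x] /= T0 gxT xM.
have [gamma1 [x1 [g10 x10 geo1]]] := dP _ xM.
pose gamma2 s := (gamma T * gamma1 (s - T)%R)%g; pose x2 s := x1 (s - T).
have geo2 t : `|t - T| <= delta -> geod gamma2 x2 t.
  by move=> /geo1; exact: geodesic_at_translate.
have g2T : gamma2 T = gamma T by rewrite /gamma2 subrr g10 mulg1.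
have x2T : x2 T = x T by rewrite /x2 subrr x10.
exists (fun s => if s <= T then gamma s else gamma2 s,
        fun s => if s <= T then x s else x2 s); last by move=> t /= ->.
move=> t /andP[t0 td] /=.
have [tT|Tt|->] := ltgtP t T.
- apply: geodesic_at_near (gxT t _); last by rewrite t0 ltW.
  near=> s; have sT : s <= T by apply: ltW; near: s; exact: lt_nbhsl.
  by rewrite sT.
- apply: geodesic_at_near (geo2 t _); last first.
    by rewrite ger0_norm ?subr_ge0 ?(ltW Tt)// lerBlDl.
  near=> s; have sT : T < s by near: s; exact: lt_nbhsr.
  by rewrite leNgt sT.
- apply: (@geodesic_at_glue _ _ _ _ _ _ _ gamma gamma2 _ x x2); rewrite ?lexx//.
  + by move=> s; case: ifP; [left|right].
  + by apply: gxT; rewrite T0 lexx.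
  + by apply: geo2; rewrite subrr normr0 ltW.
Unshelve. all: by end_near. Qed.

(** A bound on velocities up to the time T + 1 makes finitely many prolongations by
    the same amount of time sufficient. *)
Lemma geodesic_extend_one T gx : 0 <= T -> geodesic_on T gx ->
  exists2 hx, geodesic_on (T + 1) hx & agree_until T gx hx.
Proof.
move=> T0 gxT; have [M MP] := bounded (gx.2 0) (T + 1).
have [delta d0 dP] := geodesic_extend M.
(* steps of length 1 / N, at most delta, reach T + 1 exactly *)
pose N := (Num.truncn delta^-1).+1.
have N0 : 0 < N%:R :> R by rewrite ltr0n.
have Nd : N%:R^-1 <= delta.
  by rewrite -[delta]invrK lef_pV2 ?posrE ?invr_gt0//; apply: ltW; exact: truncnS_gt.
suff H k : (k <= N)%N -> 
    exists2 hx, geodesic_on (T + k%:R / N%:R) hx & agree_until T gx hx.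
  by have := H N (leqnn _); rewrite divff// gt_eqF.
elim: k => [_|k ih kN].
  by exists gx => //; rewrite mul0r addr0.
have [hx hxk agr] := ih (ltnW kN).
have k0 : 0 <= k%:R / N%:R :> R by rewrite divr_ge0.
have k1 : k%:R / N%:R <= 1 :> R by rewrite ler_pdivrMr// mul1r ler_nat ltnW.
have [|||kx kxP agr'] := dP (T + k%:R / N%:R) hx.
- exact: addr_ge0.
- exact: hxk.
- apply: (MP hx.2 (T + k%:R / N%:R)); rewrite ?lerD2l//.
  + by have [_ ->] := agr 0 T0.
  + by move=> t /hxk[].
  + by rewrite addr_ge0//= lexx.
exists kx.
  move=> t /andP[t0 tk]; apply: kxP; rewrite t0/=; apply: le_trans tk _.
  by rewrite -addrA lerD2l -natr1 mulrDl mul1r lerD2l.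
move=> t tT; have [-> ->] := agr t tT; apply: agr'.
by apply: le_trans tT _; rewrite lerDl.
Qed.

(** Prolonging by one unit of time again and again gives a sequence of geodesics,
    each of which agrees with the previous ones on their domains. *)
Lemma geodesic_forward (p : G) (u : g) : exists (gamma : R -> G) (x : R -> g),
  [/\ gamma 0 = p, x 0 = u & forall t, 0 <= t -> geod gamma x t].
Proof.
pose good k gx := [/\ gx.1 0 = p, gx.2 0 = u & geodesic_on k%:R gx].
have start : {gx | good 0%N gx}.
  apply: cid.
  have [delta d0 dP] := local_geodesic c_atlas c_one i_bij (\sum_j `|i u 0 j|).
  have [|gamma [x [g0 x0 gx]]] := dP u.
    by move=> j; rewrite (bigD1 j)//= lerDl sumr_ge0.
  exists (fun s => p * gamma (s - 0)%R, fun s => x (s - 0))%g; split => /=.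
  - by rewrite subr0 g0 mulg1.
  - by rewrite subr0 x0.
  - move=> t; rewrite -eq_le => /eqP <-; apply: geodesic_at_translate.
    by apply: gx; rewrite subr0 normr0 ltW.
have next k (s : {gx | good k gx}) : {s' : {gx | good k.+1 gx} |
    agree_until k%:R (sval s) (sval s')}.
  apply: cid; case: s => gx [g0 x0 gxk] /=.
  have [hx hxk agr] := geodesic_extend_one (ler0n _ k) gxk.
  have [agr1 agr2] := agr 0 (ler0n _ k).
  have hgood : good k.+1 hx.
    by split; rewrite -?agr1 -?agr2// -natr1.
  by exists (exist _ hx hgood).
pose S := fix S k : {gx | good k gx} := match k with
  | 0 => start | k'.+1 => sval (next k' (S k')) end.
have Sagree k m t : (k <= m)%N -> t <= k%:R ->
    (sval (S k)).1 t = (sval (S m)).1 t /\ (sval (S k)).2 t = (sval (S m)).2 t.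
  move=> km tk; elim: m km => [|m ih]; first by rewrite leqn0 => /eqP ->.
  rewrite leq_eqVlt => /predU1P[->//|km]; have [-> ->] := ih km.
  apply: (svalP (next m (S m))); apply: le_trans tk _; by rewrite ler_nat.
pose N (t : R) := (Num.truncn `|t|).+1.
have tN t : t < (N t)%:R by apply: le_lt_trans (ler_norm _) _; exact: truncnS_gt.
exists (fun t => (sval (S (N t))).1 t), (fun t => (sval (S (N t))).2 t); split.
- by case: (svalP (S (N 0))).
- by case: (svalP (S (N 0))).
move=> t t0; have [_ _ /(_ t)] := svalP (S (N t)).
rewrite t0 (ltW (tN t)) => /(_ isT); apply: geodesic_at_near.
near=> s; have sN : s <= (N t)%:R by apply: ltW; near: s; exact: lt_nbhsl.
by have [le|/ltnW le] := leqP (N t) (N s);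
  [apply: Sagree | have [-> ->] := Sagree _ _ s le (ltW (tN s))].
Unshelve. all: by end_near. Qed.

(** The past of a geodesic is the reflection of the future of the one with the
    opposite initial velocity. *)
Lemma geodesically_complete_bounded : geodesically_complete c i.
Proof.
move=> p u.
have [gp [xp [gp0 xp0 fwd]]] := geodesic_forward p u.
have [gm [xm [gm0 xm0 bwd]]] := geodesic_forward p (- u).
pose gamma t := if t <= 0 then gm (- t) else gp t.
pose x t := if t <= 0 then - xm (- t) else xp t.
have g0 : gamma 0 = p by rewrite /gamma lexx oppr0.
have x0 : x 0 = u by rewrite /x lexx oppr0 xm0 opprK.
have bwd' t : t <= 0 -> geod (fun s => gm (- s)) (fun s => - xm (- s)) t.
  by move=> t0; apply: geodesic_at_reflect; apply: bwd; rewrite oppr_ge0.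
have geo t : geod gamma x t.
  have [t0|t0|->] := ltgtP t 0.
  - apply: geodesic_at_near (bwd' t (ltW t0)).
    near=> s; have s0 : s <= 0 by apply: ltW; near: s; exact: lt_nbhsl.
    by rewrite /gamma /x s0.
  - apply: geodesic_at_near (fwd t (ltW t0)).
    near=> s; have s0 : 0 < s by near: s; exact: lt_nbhsr.
    by rewrite /gamma /x leNgt s0.
  - apply: (geodesic_at_glue _ _ _ _ _ (bwd' 0 (lexx 0)) (fwd 0 (lexx 0))).
    + by move=> s; rewrite /gamma /x; case: ifP; [left|right].
    + by rewrite oppr0 gm0 g0.
    + by rewrite gp0 g0.
    + by rewrite oppr0 xm0 opprK x0.
    + by rewrite xp0 x0.
exists gamma, x; split=> //; split; first split.
- by move=> t; case: (geo t).
- by move=> t; case: (geo t).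
- by move=> t; case: (geo t).
Unshelve. all: by end_near. Qed.
End Completeness.

(** * Velocities on a double extension *)

Section RiemannianBounds.
Variables (R : realType) (B : prLieAlgebra R).
Hypothesis riemB : riemannian B.
Local Notation ip := (lie_ip B).
Implicit Types (a b p : B).

Lemma riemannian_ge0 a : 0 <= ip a a.
Proof.
by have [->|/riemB/ltW//] := eqVneq a 0; rewrite ip0l.
Qed.

(** Expand the square norm of <p, p> a - <p, a> p. *)
Lemma riemannian_cauchy_schwarz p a : ip p a ^+ 2 <= ip p p * ip a a.
Proof.
have [->|/riemB p0] := eqVneq p 0; first by rewrite !ip0l mul0r expr2 mul0r.
have := riemannian_ge0 (ip p p *: a - ip p a *: p).
have -> : ip (ip p p *: a - ip p a *: p) (ip p p *: a - ip p a *: p) =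
  ip p p * (ip p p * ip a a - ip p a ^+ 2) by rewrite !ipE (ipC a p); ring.
by rewrite pmulr_rge0// subr_ge0.
Qed.

Lemma linear_form_bound (phi : {linear B -> R^o}) :
  exists2 C : R, 0 <= C & forall a, phi a ^+ 2 <= C * ip a a.
Proof.
exists (ip (lie_riesz phi) (lie_riesz phi)); first exact: riemannian_ge0.
by move=> a; rewrite -(lie_rieszP phi) riemannian_cauchy_schwarz.
Qed.

Lemma linear_form_bound1 (phi : {linear B -> R^o}) :
  exists2 C : R, 0 <= C & forall a, `|phi a| <= C * (1 + ip a a).
Proof.
have [C C0 CP] := linear_form_bound phi; exists (C + 1); first exact: addr_ge0.
move=> a; have a0 := riemannian_ge0 a; have Ca := mulr_ge0 C0 a0.
have := CP a; rewrite ler_norml => h; have := sqr_ge0 (phi a + 1).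
have := sqr_ge0 (phi a - 1); rewrite !expr2 in h * => h1 h2.
apply/andP; split; nra.
Qed.

(** In a basis, <F a, a> is a sum of products of two linear forms in a, and each
    linear form is represented by a vector. *)
Lemma quadratic_bound (F : 'End(B)) :
  exists2 C : R, 0 <= C & forall a, `|ip (F a) a| <= C * ip a a.
Proof.
pose b := vbasis {:B}.
pose phi k : {linear B -> R^o} := coord b k.
have psi_lin k : linear (ip (F b`_k) : B -> R^o).
  by move=> m u v; rewrite !ipE.
pose psi k : {linear B -> R^o} :=
  HB.pack (ip (F b`_k) : B -> R^o) (GRing.isLinear.Build _ _ _ _ _ (psi_lin k)).
have sumE a : ip (F a) a = \sum_k phi k a * psi k a.
  rewrite {1}(coord_vbasis (memvf a)) linear_sum ip_suml.
  by apply: eq_bigr => k _; rewrite linearZ ipZl.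
have [C CP] : exists C : 'I_(\dim {:B}) -> R, forall k, 0 <= C k /\
    forall a, `|phi k a * psi k a| <= C k * ip a a.
  have H k : {C : R | 0 <= C /\ forall a, `|phi k a * psi k a| <= C * ip a a}.
    apply: cid; have [C1 C10 h1] := linear_form_bound (phi k).
    have [C2 C20 h2] := linear_form_bound (psi k).
    exists (C1 + C2); split=> [|a]; first exact: addr_ge0.
    have := h1 a; have := h2 a; rewrite mulrDl ler_norml !expr2 => q1 q2.
    have := sqr_ge0 (phi k a + psi k a); have := sqr_ge0 (phi k a - psi k a).
    rewrite !expr2 => p1 p2; have := mulr_ge0 C10 (riemannian_ge0 a).
    have := mulr_ge0 C20 (riemannian_ge0 a) => r1 r2.
    by apply/andP; split; nra.
  by exists (fun k => projT1 (H k)) => k; exact: (projT2 (H k)).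
exists (\sum_k C k); first by apply: sumr_ge0 => k _; case: (CP k).
move=> a; rewrite sumE mulr_suml; apply: le_trans (ler_norm_sum _ _ _) _.
by apply: ler_sum => k _; case: (CP k) => _; apply.
Qed.
End RiemannianBounds.

Section CurveDerive.
Variable R : realType.

(** A derivative of curves in a space without a chosen norm, tested on linear forms. *)
Definition curve_derive (V : vectType R) (x : R -> V) (t : R) (d : V) : Prop :=
  forall phi : {linear V -> R^o},
    is_derive t (1 : R) (fun s => phi (x s) : R) (phi d : R).

Lemma curve_derive_linear (V W : vectType R) (f : {linear V -> W}) x t d :
  curve_derive x t d -> curve_derive (fun s => f (x s)) t (f d).
Proof.
move=> xd phi.
have phif : linear (fun y => phi (f y) : R^o) by move=> k u v; rewrite !linearP.
exact: (xd (HB.pack (fun y => phi (f y) : R^o) (GRing.isLinear.Build _ _ _ _ _ phif))).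
Qed.

(** In a basis the form is a sum of products of two linear forms. *)
Lemma curve_derive_ip (B : prLieAlgebra R) (x : R -> B) t d : curve_derive x t d ->
  is_derive t (1 : R) (fun s => lie_ip B (x s) (x s)) (2 * lie_ip B d (x t)).
Proof.
move=> xd; pose b := vbasis {:B}.
have psi_lin k : linear (lie_ip B b`_k : B -> R^o) by move=> m u v; rewrite !ipE.
pose psi k : {linear B -> R^o} :=
  HB.pack (lie_ip B b`_k : B -> R^o) (GRing.isLinear.Build _ _ _ _ _ (psi_lin k)).
have ipEsum u v : lie_ip B u v = \sum_k coord b k u * psi k v.
  by rewrite {1}(coord_vbasis (memvf u)) ip_suml; apply: eq_bigr => k _; rewrite ipZl.
have -> : (fun s => lie_ip B (x s) (x s)) =
    \sum_(k < \dim {:B}) ((fun s => coord b k (x s)) * (fun s => psi k (x s))).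
  by apply/funext => s; rewrite ipEsum fct_sumE.
have -> : 2 * lie_ip B d (x t) =
    \sum_k (coord b k (x t) *: (psi k d : R) + (psi k (x t) : R) *: (coord b k d : R)).
  rewrite mulr_natl mulr2n {2}[lie_ip B d _]ipC !ipEsum -big_split /=.
  by apply: eq_bigr => k _; rewrite /GRing.scale /=; ring.
apply: is_derive_sum => k; apply: is_deriveM.
  exact: (xd (coord b k)).
exact: (xd (psi k)).
Qed.
End CurveDerive.

Section Velocity.
Variables (R : realType) (g : prLieAlgebra R) (n : nat) (i : 'Hom(g, 'rV[R]_n)).
Hypothesis i_bij : bijective i.

Lemma curve_derive_of_chart x t d :
  is_derive t (1 : R) (fun s => i (x s)) (i d) -> curve_derive x t d.
Proof.
move=> xd phi.
have [h ihK hiK] := i_bij.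
have phiE y : phi y = \sum_k (i y) 0 k * phi (h 'e_k).
  have {1}-> : y = \sum_k (i y) 0 k *: h 'e_k.
    apply: (can_inj ihK); rewrite linear_sum [LHS]row_sum_delta.
    by apply: eq_bigr => k _; rewrite linearZ /= hiK.
  by rewrite linear_sum; apply: eq_bigr => k _; rewrite linearZ.
have coordD k : is_derive t (1 : R) (fun s => i (x s) 0 k) (i d 0 k).
  have [xd1 xd2] := xd; have xd3 := (derivable_mxP _ _ _).1 xd1 0 k.
  by apply: DeriveDef => //; rewrite -xd2 derive_mx// mxE.
have -> : (fun s => phi (x s) : R) = \sum_(k < n) (fun s => i (x s) 0 k * phi (h 'e_k)).
  by apply/funext => s; rewrite phiE fct_sumE.
rewrite phiE; apply: is_derive_sum => k.
have -> : (fun s => i (x s) 0 k * phi (h 'e_k)) =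
    (phi (h 'e_k) : R) *: (fun s => i (x s) 0 k).
  by apply/funext => s; rewrite mulrC.
by rewrite mulrC; exact: is_deriveZ.
Qed.


Variables (B : prLieAlgebra R) (xi D : 'End(B)) (b0 : B) (f : 'Hom(g, dext_space B)).
Hypotheses (riemB : riemannian B) (Dxi_skew : skew_symmetric_lfun (D - xi)).
Hypothesis f_bij : bijective f.
Hypothesis f_br : forall u v, f (lie_br g u v) = dext_br xi D 0 b0 (f u) (f v).
Hypothesis f_ip : forall u v, dext_ip (f u) (f v) = lie_ip g u v.
Local Notation ip := (lie_ip B).

(** The function N t * exp (- C t) is nonincreasing. *)
Lemma gronwall_exp (N dN : R -> R) (C T : R) : 0 <= T -> 
  (forall t, 0 <= t <= T -> is_derive t (1 : R) N (dN t)) ->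
  (forall t, 0 <= t <= T -> dN t <= C * N t) ->
  N T <= N 0 * expR (C * T).
Proof.
move=> T0 Nd NC.
pose E (t : R) := - (N t * expR (- C * t)).
have Ed t : 0 <= t <= T -> is_derive t (1 : R) E (- (dN t - C * N t) * expR (- C * t)).
  move=> tT; have h : is_derive t (1 : R) (fun t : R => - C * t) (- C).
    by apply: is_derive_eq; rewrite /GRing.scale /= mulr1.
  have h2 := is_derive1_comp (is_derive_expR (- C * t)) h.
  have := is_deriveN (is_deriveM (Nd t tT) h2); rewrite /GRing.scale /= => h3.
  by apply: is_derive_eq; ring.
have : E 0 <= E T.
  apply: (is_derive_nondecreasing T0 Ed) => t tT.
  by rewrite mulr_ge0 ?expR_ge0// oppr_ge0 subr_le0 NC.
rewrite /E mulr0 expR0 mulr1 lerN2 mulNr expRN -ler_pdivlMr ?invr_gt0 ?expR_gt0//.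
by rewrite invrK.
Qed.

(** In coordinates x = (s, a, t), the equation x' = - x x reads t' = 0,
    a' = - a a + t xi a - t (D - xi) a - t^2 b0 and
    s' = - <xi a, a> + t <b0, a>. As a |-> b a and D - xi are skew,
    (1 + |a|^2)' <= C (1 + |a|^2) with C depending on t only; this bounds a, then
    s' and s. *)
Lemma dext_velocity_bounded : velocity_bounded i.
Proof.
move=> u T.
have [C1 C10 h1] := quadratic_bound riemB xi.
have b0_lin : linear (ip b0 : B -> R^o) by move=> m x y; rewrite !ipE.
have [C2 C20 h2] := linear_form_bound1 riemB
  (HB.pack (ip b0 : B -> R^o) (GRing.isLinear.Build _ _ _ _ _ b0_lin)).
rewrite /= in h2.
have [fi fK fiK] := f_bij.
have fi_lin : linear fi.
  by move=> k x y; apply: (can_inj fK); rewrite linearP /= !fiK.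
pose tau := (f u).2; pose N0 := ip (f u).1.2 (f u).1.2.
(* C is the growth rate of 1 + |a|^2, E its bound up to time T, S that of |s| *)
pose C := 2 * `|tau| * C1 + 2 * tau ^+ 2 * C2.
pose E := (1 + N0) * expR (C * `|T|).
pose S := `|(f u).1.1| + (C1 + `|tau| * C2) * E * `|T|.
have lin_i j : linear (fun a : B => i (fi ((0 : R^o), a, (0 : R^o))) 0 j : R^o).
  move=> k a b.
  have -> : ((0 : R^o), k *: a + b, (0 : R^o)) =
      k *: ((0 : R^o), a, (0 : R^o)) + ((0 : R^o), b, (0 : R^o)) :> dext_space B.
    by rewrite -[RHS]/(k *: 0 + 0, k *: a + b, k *: 0 + 0) !scaler0 !addr0.
  by rewrite fi_lin linearP !mxE.
pose P j : {linear B -> R^o} := HB.pack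
   (fun a : B => i (fi ((0 : R^o), a, (0 : R^o))) 0 j : R^o)
   (GRing.isLinear.Build _ _ _ _ _ (lin_i j)).
have [CP CPP] : exists CP : 'I_n -> R, forall j,
    0 <= CP j /\ forall a, `|P j a| <= CP j * (1 + ip a a).
  have H j : {C : R | 0 <= C /\ forall a, `|P j a| <= C * (1 + ip a a)}.
    by apply: cid; have [C3 ? ?] := linear_form_bound1 riemB (P j); exists C3.
  by exists (fun j => projT1 (H j)) => j; exact: (projT2 (H j)).
pose z1 : dext_space B := (1, 0, 0); pose z2 : dext_space B := (0, 0, 1).
pose M j := S * `|i (fi z1) 0 j| + CP j * E + `|tau| * `|i (fi z2) 0 j|.
exists (\sum_j `|M j|) => x T' x0 T'T xd.
have xcd t : 0 <= t <= T' ->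
    curve_derive (fun s => f (x s)) t (- dext_lc xi D b0 (f (x t)) (f (x t))).
  move=> /xd /curve_derive_of_chart /(curve_derive_linear f).
  by rewrite linearN /= (dext_lcE Dxi_skew f_bij f_br f_ip).
have lin3 : linear (fun y : dext_space B => y.2 : R^o) by [].
have lin1 : linear (fun y : dext_space B => y.1.1 : R^o) by [].
have lin2 : linear (fun y : dext_space B => y.1.2 : B) by [].
pose p3 : {linear dext_space B -> R^o} := HB.pack (fun y : dext_space B => y.2 : R^o)
  (GRing.isLinear.Build _ _ _ _ _ lin3).
pose p1 : {linear dext_space B -> R^o} := HB.pack (fun y : dext_space B => y.1.1 : R^o)
  (GRing.isLinear.Build _ _ _ _ _ lin1).
pose p2 : {linear dext_space B -> B} := HB.pack (fun y : dext_space B => y.1.2 : B)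
  (GRing.isLinear.Build _ _ _ _ _ lin2).
have tau_cst t : 0 <= t <= T' -> (f (x t)).2 = tau.
  move=> /andP[t0 tT].
  pose q (s : R) : R := (f (x s)).2; pose o : R -> R := cst (0 : R).
  have : q t - q 0 = o t - o 0.
    apply: (is_derive_increment_eq (df := o) t0) => s.
      move=> /andP[s0 st]; have := xcd s _ p3.
      rewrite s0 (le_trans st tT) => /(_ isT); rewrite /= /dext_lc.
      by case: (f (x s)) => [[s1 a] t1] /=; rewrite oppr0.
  by rewrite /q /o subrr x0 => /eqP; rewrite subr_eq0 => /eqP.
pose a t := (f (x t)).1.2; pose N t := ip (a t) (a t).
have dN t : 0 <= t <= T' -> is_derive t (1 : R) N
    (2 * (tau * ip (xi (a t)) (a t) - tau ^+ 2 * ip b0 (a t))).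
  move=> tT; have := curve_derive_ip (curve_derive_linear p2 (xcd t tT)).
  rewrite /= -/(a t) => h; apply: is_derive_eq; congr (_ * _).
  have := tau_cst t tT; rewrite /a /dext_lc.
  case: (f (x t)) => [[s1 b] t1] /= ->.
  have Dxi0 : ip (D b) b = ip (xi b) b.
    have := Dxi_skew b b; rewrite !(add_lfunE, opp_lfunE) !ipE.
    by rewrite (ipC b) (ipC b (xi b)) => ?; lra.
  by rewrite !ipE lc_skew0 Dxi0; ring.
have C0 : 0 <= C.
  by apply: addr_ge0; rewrite mulr_ge0// mulr_ge0// sqr_ge0.
have N_ge0 t : 0 <= N t by exact: riemannian_ge0.
have NE t : 0 <= t <= T' -> 1 + N t <= E.
  move=> /andP[t0 tT].
  have tT' s : 0 <= s <= t -> 0 <= s <= T'.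
    by move=> /andP[-> st] /=; exact: le_trans st tT.
  have := @gronwall_exp (fun s => 1 + N s)
    (fun s => 2 * (tau * ip (xi (a s)) (a s) - tau ^+ 2 * ip b0 (a s))) C t t0.
  have -> : 1 + N 0 = 1 + N0 by rewrite /N /a x0.
  move=> H; apply: le_trans (H _ _) _ => [s st|s st|].
  - have := is_deriveD (is_derive_cst (1 : R) s (1 : R)) (dN s (tT' s st)).
    by rewrite add0r.
  - have q1 : tau * ip (xi (a s)) (a s) <= `|tau| * (C1 * N s).
      by apply: le_trans (ler_norm _) _; rewrite normrM ler_wpM2l// h1.
    have q2 : - (tau ^+ 2 * ip b0 (a s)) <= tau ^+ 2 * (C2 * (1 + N s)).
      rewrite -mulrN ler_wpM2l ?sqr_ge0//; apply: le_trans (h2 _).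
      by rewrite -normrN ler_norm.
    have q3 : 0 <= `|tau| * C1 by rewrite mulr_ge0.
    by rewrite /C; nra.
  - apply: ler_wpM2l; first by rewrite addr_ge0// riemannian_ge0.
    rewrite ler_expR ler_wpM2l//; apply: le_trans tT _; apply: le_trans T'T _.
    exact: ler_norm.
have K0 : 0 <= C1 + `|tau| * C2 by rewrite addr_ge0// mulr_ge0.
have E0 : 0 <= E by rewrite mulr_ge0 ?expR_ge0// addr_ge0// riemannian_ge0.
pose sc (t : R) : R := (f (x t)).1.1.
have dsc t : 0 <= t <= T' -> is_derive t (1 : R) sc
    (- (ip (xi (a t)) (a t) - tau * ip b0 (a t))).
  move=> tT; have := xcd t tT p1; rewrite /= => h; apply: is_derive_eq.
  have := tau_cst t tT; rewrite /a /dext_lc.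
  by case: (f (x t)) => [[s1 b] t1] /= ->.
have scS t : 0 <= t <= T' -> `|sc t| <= S.
  move=> /andP[t0 tT].
  have tT' s : 0 <= s <= t -> 0 <= s <= T'.
    by move=> /andP[-> st] /=; exact: le_trans st tT.
  have sc0 : sc 0 = (f u).1.1 by rewrite /sc x0.
  have : `|sc t - sc 0| <= (C1 + `|tau| * C2) * E * t - (C1 + `|tau| * C2) * E * 0.
    apply: (@is_derive_le_norm R sc _ (fun s => (C1 + `|tau| * C2) * E * s)
      (fun=> (C1 + `|tau| * C2) * E) 0 t t0 (fun s st => dsc s (tT' s st))) => s st.
      by apply: is_derive_eq; rewrite /GRing.scale /= mulr1.
    rewrite normrN; apply: le_trans (ler_normB _ _) _; rewrite normrM.
    have q1 := h1 (a s); have q2 := h2 (a s).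
    have q3 := NE s (tT' s st); have q4 : N s <= E by lra.
    rewrite -/(N s) in q1 q2; rewrite mulrDl -mulrA; apply: lerD.
      by apply: le_trans q1 _; apply: ler_wpM2l.
    by apply: ler_wpM2l => //; apply: le_trans q2 _; apply: ler_wpM2l.
  rewrite mulr0 subr0 => h; rewrite -[sc t](subrK (sc 0)) addrC.
  apply: le_trans (ler_normD _ _) _; rewrite /S sc0; apply: lerD => //.
  rewrite sc0 in h; apply: le_trans h _; apply: ler_wpM2l; first exact: mulr_ge0.
  by apply: le_trans tT _; apply: le_trans T'T _; exact: ler_norm.
move=> t tT j.
have xE : f (x t) = sc t *: z1 + ((0 : R^o), a t, (0 : R^o)) + tau *: z2 :> dext_space B.
  have := tau_cst t tT; rewrite /sc /a; case: (f (x t)) => [[s1 b] t1] /= ->.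
  rewrite -[RHS]/(s1 *: (1 : R^o) + 0 + tau *: (0 : R^o), s1 *: 0 + b + tau *: 0,
    s1 *: (0 : R^o) + 0 + tau *: (1 : R^o)).
  by rewrite !scaler0 !addr0 !add0r /GRing.scale /= !mulr1.
have ixE : i (x t) 0 j = sc t * i (fi z1) 0 j + P j (a t) + tau * i (fi z2) 0 j.
  rewrite -[x t]fK xE.
  pose FI : {linear dext_space B -> g} :=
    HB.pack fi (GRing.isLinear.Build _ _ _ _ _ fi_lin).
  by rewrite -[fi]/(FI : dext_space B -> g) !linearD !linearZ /= !mxE.
apply: (@le_trans _ _ (M j)); last first.
  apply: le_trans (ler_norm _) _; rewrite (bigD1 j)//= lerDl.
  by apply: sumr_ge0.
rewrite ixE /M; apply: le_trans (ler_normD _ _) _; apply: lerD.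
  apply: le_trans (ler_normD _ _) _; apply: lerD.
    by rewrite normrM; apply: ler_wpM2r => //; exact: scS.
  have [CPj h] := CPP j; apply: le_trans (h _) _; apply: ler_wpM2l => //.
  exact: NE.
by rewrite normrM.
Qed.
End Velocity.

(** * The characterization theorem *)

Theorem theorem2p1 (R : realType) (g : prLieAlgebra R) :
  lorentzian g -> degenerate_on (lie_center g) ->
  (flat g <->
     exists (B : prLieAlgebra R) (xi D : 'End(B)) (b0 : B),
       [/\ riemannian B, flat B, admissible xi D 0%R b0,
           (D, b0) <> (0%R, 0%R)
         & is_double_extension xi D 0%R b0 g])
  /\ (flat g -> unimodular g /\ complete_metric g).
Proof.
move=> Lg Cg; split; first split.
- exact: flat_is_double_extension.
- move=> [B [xi [D [b0 [_ fB adm _ [f [f_bij f_br f_ip]]]]]]].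
  have [_ _ [skew _ _]] := adm.
  exact: (dext_flat skew f_bij f_br f_ip fB adm).
move=> fg; split; first exact: lorentzian_flat_unimodular.
move=> n G c i [c_atlas c_one i_bij _].
have [B [xi [D [b0 [riemB _ [_ _ [skew _ _]] _ [f [f_bij f_br f_ip]]]]]]] :=
  flat_is_double_extension Lg Cg fg.
apply: (geodesically_complete_bounded c_atlas c_one i_bij).
exact: (dext_velocity_bounded i_bij riemB skew f_bij f_br f_ip).
Qed.
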